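(* Let $n\geq2$, $\alpha>n$, $\beta\geq0$, $\theta>0$, $k>0$, $\theta\neq1$, $k\neq1$ satisfy $\beta(1-k)+1>0$. Assume that there exists a pair of positive $C^1$ functions $(u,v)\in C^1(\partial\mathbb{R}^n_+)\times C^1(\mathbb{R}^n_+)$ satisfying $$u(y)=\int_{\mathbb{R}^n_+}\frac{x_n^{\beta(1-k)}}{|x-y|^{n-\alpha}}v^{-k}(x)\,dx,\quad y\in\partial\mathbb{R}^n_+,\qquad v(x)=\int_{\partial\mathbb{R}^n_+}\frac{1}{|x-y|^{n-\alpha}}u^{-\theta}(y)\,dy,\quad x\in\mathbb{R}^n_+ .$$ Then $$\frac{n-1}{\theta-1}+\frac{n}{k-1}=\alpha+\beta-n .$$
   Context: $\mathbb{R}^n_+=\{x\in\mathbb{R}^n: x_n>0\}$, and $\partial\mathbb{R}^n_+=\{x_n=0\}$ is identified with $\mathbb{R}^{n-1}$ with Lebesgue measure. *)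

(* Defs.v *)
From HB Require Import structures.
From mathcomp Require Import all_boot all_order all_algebra.
From mathcomp Require Import all_classical all_reals all_analysis.

Set Implicit Arguments.
Unset Strict Implicit.
Unset Printing Implicit Defensive.

Import Order.TTheory GRing.Theory Num.Theory.
Import numFieldNormedType.Exports.

Local Open Scope classical_set_scope.
Local Open Scope ring_scope.

(* R^n is 'rV[R]_n.  Its library norm `|x| is the sup norm, which is only used
   through the (norm-independent) topology and differentiability. *)
Definition enorm (R : realType) (n : nat) (x : 'rV[R]_n) : R :=
  Num.sqrt (\sum_(i < n) x ord0 i ^+ 2).

(* (x', t) in R^n x R, seen as a point of R^(n+1). *)
Definition snoc (R : realType) (n : nat) (x' : 'rV[R]_n) (t : R) : 'rV[R]_n.+1 :=
  \row_(i < n.+1) if unlift ord_max i is Some j then x' ord0 j else t.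

Definition lastc (R : realType) (n : nat) (x : 'rV[R]_n.+1) : R := x ord0 ord_max.

Definition halfspace (R : realType) (n : nat) : set 'rV[R]_n.+1 :=
  [set x | 0 < lastc x].

Arguments halfspace : clear implicits.

(* Meant for open D: f is differentiable on D and the differential is
   continuous on D. *)
Definition C1_on (R : realType) (n : nat) (D : set 'rV[R]_n) (f : 'rV[R]_n -> R) :=
  forall x, D x ->
    differentiable f x /\
    forall w : 'rV[R]_n, {for x, continuous (fun z => 'D_w f z)}.

(* The sigma-algebra of R^n is generated by the coordinates, that is, it is the
   n-fold product of the Borel sigma-algebra of R. *)
Definition rV_display : measure_display.
Proof. exact default_measure_display. Qed.

Section measurable_rV.
Variables (R : realType) (n : nat).

Let coord : 'I_n -> 'rV[R]_n -> measurableTypeR R := fun i x => x ord0 i.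

Let rV_set0 : g_sigma_preimage coord set0.
Proof. exact: sigma_algebra0. Qed.

Let rV_setC A : g_sigma_preimage coord A -> g_sigma_preimage coord (~` A).
Proof. exact: sigma_algebraC. Qed.

Let rV_bigcup (F : _^nat) : (forall i, g_sigma_preimage coord (F i)) ->
  g_sigma_preimage coord (\bigcup_i (F i)).
Proof. exact: sigma_algebra_bigcup. Qed.

HB.instance Definition _ := @isMeasurable.Build rV_display
  'rV[R]_n (g_sigma_preimage coord) rV_set0 rV_setC rV_bigcup.

Lemma measurable_coord (i : 'I_n) :
  measurable_fun [set: 'rV[R]_n] (fun x => x ord0 i : measurableTypeR R).
Proof.
move=> _ Y mY; rewrite setTI; apply: sub_sigma_algebra => /=.
rewrite -bigcup_seq/=; exists i => /=; first by rewrite mem_index_enum.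
by exists Y => //; rewrite setTI.
Qed.

Lemma measurable_fun_rV d (T : measurableType d) (f : T -> 'rV[R]_n) :
  (forall i, measurable_fun [set: T] (fun x => f x ord0 i : measurableTypeR R)) ->
  measurable_fun [set: T] f.
Proof.
move=> mf.
have prefS : g_sigma_preimage (fun i => coord i \o f) `<=` measurable.
  apply: smallest_sub; first exact: sigma_algebra_measurable.
  rewrite -bigcup_seq/=; apply: bigcup_sub => i _.
  by move=> A [B mB <-]; exact: mf.
move=> _ A mA; apply: prefS.
by rewrite g_sigma_preimage_comp; exists A.
Qed.

End measurable_rV.

Lemma measurable_snoc (R : realType) (n : nat) :
  measurable_fun [set: 'rV[R]_n * measurableTypeR R]
    (fun p => snoc p.1 p.2).
Proof.
apply: measurable_fun_rV => i.
rewrite [X in measurable_fun _ X](_ : _ = fun p : 'rV[R]_n * R =>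
    if unlift ord_max i is Some j then p.1 ord0 j else p.2); last first.
  by apply/funext => p; rewrite mxE.
case: unlift => [j|]; last exact: measurable_snd.
exact: (measurableT_comp (measurable_coord j) measurable_fst).
Qed.

(* Lebesgue measure on R^(n+1) is the image under snoc of the product measure on
   R^n x R; on R^0 it is the unit mass at the only point. *)
Section lebesgue_step.
Local Open Scope ereal_scope.
Variables (R : realType) (n : nat).
Variable mu : {sigma_finite_measure set 'rV[R]_n -> \bar R}.

Definition lebesgue_step : set 'rV[R]_n.+1 -> \bar R :=
  pushforward (mu \x @lebesgue_measure R) (fun p => snoc p.1 p.2).

Let step_measure : {measure set 'rV[R]_n.+1 -> \bar R} :=
  measure_function_pushforward__canonical__measure_function_Measure
    (mu \x @lebesgue_measure R) (@measurable_snoc R n).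

HB.instance Definition _ := isMeasure.Build _ _ _ lebesgue_step
  (measure0 step_measure) (measure_ge0 step_measure)
  (@measure_semi_sigma_additive _ _ _ step_measure).

Let step_sigma_finite : sigma_finite setT lebesgue_step.
Proof.
have /sigma_finiteP[F [TF ndF Foo]] := sigma_finiteT mu.
have /sigma_finiteP[G [TG ndG Goo]] := sigma_finiteT (@lebesgue_measure R).
pose H k := F k `*` G k.
have TH : [set: 'rV[R]_n * measurableTypeR R] = \bigcup_k H k.
  apply/esym; rewrite -subTset => -[x t] _.
  have [i _ Fx] : (\bigcup_k F k) x by rewrite -TF.
  have [j _ Gt] : (\bigcup_k G k) t by rewrite -TG.
  exists (maxn i j) => //; split => /=.
    by move: Fx; exact/subsetPset/ndF/leq_maxl.
  by move: Gt; exact/subsetPset/ndG/leq_maxr.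
pose split_rV (x : 'rV[R]_n.+1) : 'rV[R]_n * measurableTypeR R :=
  (\row_j x ord0 (lift ord_max j), x ord0 ord_max).
have snocK p : split_rV (snoc p.1 p.2) = p.
  case: p => x t; rewrite /split_rV /snoc; congr (_, _).
    by apply/rowP => j; rewrite !mxE liftK.
  by rewrite mxE unlift_none.
have msplit : measurable_fun setT split_rV.
  apply/measurable_fun_pairP; split.
    apply: measurable_fun_rV => j /=.
    rewrite [X in measurable_fun _ X](_ : _ =
      fun x : 'rV[R]_n.+1 => x ord0 (lift ord_max j)); last first.
      by apply/funext => x; rewrite mxE.
    exact: measurable_coord.
  exact: measurable_coord.
exists (fun k => split_rV @^-1` H k).
  by rewrite -preimage_bigcup -TH preimage_setT.
move=> k; have [mF Fkoo] := Foo k; have [mG Gkoo] := Goo k; split.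
  by rewrite -[X in measurable X]setTI; apply: msplit => //; exact: measurableX.
rewrite /lebesgue_step /pushforward -comp_preimage.
rewrite (_ : _ \o _ = id); last by apply/funext => p; exact: snocK.
by rewrite preimage_id product_measure1E// lte_mul_pinfty// ge0_fin_numE.
Qed.

HB.instance Definition _ := Measure_isSigmaFinite.Build _ _ _ lebesgue_step
  step_sigma_finite.

End lebesgue_step.

Fixpoint lebesgue_rV (R : realType) (n : nat) :
    {sigma_finite_measure set 'rV[R]_n -> \bar R} :=
  if n is n'.+1 then lebesgue_step (lebesgue_rV R n')
  else dirac (0 : 'rV[R]_0).

Lemma lebesgue_rV_box (R : realType) (n : nat) (A : 'I_n -> set (measurableTypeR R)) :
  (forall i, measurable (A i)) ->
  lebesgue_rV R n [set x | forall i, A i (x ord0 i)] =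
  (\big[*%E/1]_(i < n) lebesgue_measure (A i))%E.
Proof.
elim: n A => [A _|n IH A mA] /=.
  by rewrite big_ord0 diracE mem_set// => -[].
pose A' i := A (lift ord_max i).
rewrite big_ord_recr /= /lebesgue_step /pushforward.
rewrite (_ : _ @^-1` _ =
  [set x : 'rV[R]_n | forall i, A' i (x ord0 i)] `*` A ord_max); last first.
  apply/seteqP; split => -[x t] /=.
    move=> H; split => [i|].
      by have := H (lift ord_max i); rewrite mxE liftK.
    by have := H ord_max; rewrite mxE unlift_none.
  move=> [Hx Ht] i; rewrite mxE.
  by case: unliftP => [j ->|->]//; exact: Hx.
have mB : measurable [set x : 'rV[R]_n | forall i, A' i (x ord0 i)].
  rewrite (_ : [set _ | _] = \bigcap_(i in [set: 'I_n])
     ((fun x : 'rV[R]_n => x ord0 i : measurableTypeR R) @^-1` A' i)); last first.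
    by apply/seteqP; split => [x Hx i _|x Hx i]; exact: Hx.
  apply: fin_bigcap_measurable => // i _.
  by rewrite -[X in measurable X]setTI; apply: measurable_coord => //; exact: mA.
rewrite product_measure1E//.
congr (_ * _)%E; rewrite [LHS]IH; last by move=> i; exact: mA.
 apply: eq_bigr => i _; rewrite /A'; congr (lebesgue_measure (A _)).
by apply/val_inj; rewrite /= /bump leqNgt ltn_ord.
Qed.

(* Main.v *)
Require Import Defs.
From HB Require Import structures.
From mathcomp Require Import all_boot all_order all_algebra.
From mathcomp Require Import all_classical all_reals all_analysis.
From mathcomp Require Import measurable_realfun ring lra.

Set Implicit Arguments.
Unset Strict Implicit.
Unset Printing Implicit Defensive.

Import Order.TTheory GRing.Theory Num.Theory.
Import numFieldNormedType.Exports.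

Local Open Scope classical_set_scope.
Local Open Scope ring_scope.

(** Put [p = alpha - n], [b = beta * (1 - k)], [f = u^(-theta)] on the boundary
    and [g = x_n^b v^(-k)] in the half-space.  The system says that [u] and [v]
    are the potentials of [g] and of [f] for the kernel [|x - y|^p].  Hence the
    energy [I], the double integral of [f(y) |x - y|^p g(x)], is also the
    integral of [u^(1 - theta)] and that of [x_n^b v^(1 - k)].  The identity
    between the exponents expresses how this energy reacts to dilations.  For
    [l > 0] consider the double integrals
      [A(l)] of [f(y) |x - l y|^p g(x)], the integral of [u^(-theta) u(l y)], and
      [B(l)] of [f(y) |l x - y|^p g(x)], the integral of [x_n^b v^(-k) v(l x)].

    Lower bounds.  The function [t^(1 - theta) / (1 - theta)] is concave, and
    its tangent inequality between [u(y)] and [u(l y)] integrates to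
    [A(l) >= I (1 + (l^(1 - n) - 1) / (1 - theta))], because the integral of
    [u(l y)^(1 - theta)] is known by a change of variables; similarly
    [B(l) >= I (1 + (l^(- n - b) - 1) / (1 - k))].  This is
    [concave_power_integral_ge]; no derivative of [u] or [v] is taken.

    Upper bound.  Since
    [|x - l y|^2 + |l x - y|^2 = 2 l |x - y|^2 + (1 - l)^2 (|x|^2 + |y|^2)],
    the sum of the two kernels exceeds [2 l^(p/2) |x - y|^p] only by a term of
    order higher than one in [1 - l] ([powR_second_difference]).  Integrated,
    [A(l) + B(l) <= 2 l^(p/2) I + C |1 - l|^(1 + e)] for some [e > 0]
    ([dilated_energy_second_difference]).

    Comparison.  The difference of the two bounds is a differentiable function
    of [l] which vanishes at [1] and is at least [- C |1 - l|^(1 + e)], so its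
    derivative at [1] vanishes ([derive_eq0_of_lower_bound]).  That derivative
    is [I (p + (n - 1) / (1 - theta) + (n + b) / (1 - k))], and [I > 0]
    ([dilation_balance]).

    The delicate point is that the remainder is integrable.  For [p <= 2] it
    carries a factor [|x - y|^(-2 s)] with [2 s < 1], singular where [x]
    approaches the boundary point [y], against [f(y) |y|^(p + 2 s)].  There a
    pointwise bound on [f] is needed: [u] is comparable with [1 + |y|^p], so [f]
    varies by a bounded factor over a cube of size and distance [|y|], and
    averaging [f |y|^p], which is integrable, over this cube bounds
    [f(y) |y|^(p + n - 1)] ([negative_power_decay]).  This is exactly the
    scale-invariant decay that makes the weighted energy finite
    ([weighted_energy_finite]). *)

(** * Inequalities for real powers *)

Section powR_inequalities.
Variable R : realType.
Implicit Types a b c s t q r x : R.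

Lemma powR_ge1 a r : 1 <= a -> 0 <= r -> 1 <= a `^ r.
Proof. by move=> a1 r0; rewrite -[leLHS](powRr0 a); exact: ler_powR. Qed.

Lemma powR_exprn a r n : 0 <= a -> (a ^+ n) `^ r = (a `^ r) ^+ n.
Proof.
move=> a0; elim: n => [|n IH]; first by rewrite !expr0 powR1.
by rewrite !exprS powRM ?exprn_ge0// IH.
Qed.

Lemma powR_add_le (a c q : R) : 0 <= a -> 0 <= c -> 0 <= q ->
  (a + c) `^ q <= 2 `^ q * a `^ q + 2 `^ q * c `^ q.
Proof.
move=> + + q0; wlog ac : a c / a <= c => [H a0 c0|a0 c0].
  have [ac|/ltW ca] := leP a c; first exact: H.
  by rewrite (addrC a) [leRHS]addrC; exact: H.
apply: (@le_trans _ _ ((2 * c) `^ q)).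
  apply: ge0_ler_powR; rewrite ?nnegrE ?addr_ge0 ?mulr_ge0//.
  by rewrite mulrDl mul1r lerD2r.
by rewrite powRM// lerDr mulr_ge0 ?powR_ge0.
Qed.

(** Bernoulli's inequality for [0 < s <= 1] is Young's inequality for the pair
    [t^s, 1] with the conjugate exponents [1/s] and [1/(1 - s)]. *)
Lemma powR_bernoulli_le t s : 0 <= t -> 0 < s -> s <= 1 -> t `^ s <= 1 + s * (t - 1).
Proof.
move=> t0 s0; rewrite le_eqVlt => /predU1P[->|s1].
  by rewrite powRr1//; lra.
have s1' : 0 < 1 - s by lra.
have := @conjugate_powR R (t `^ s) 1 s^-1 (1 - s)^-1 (powR_ge0 _ _) ler01.
rewrite !invr_gt0 !invrK => /(_ s0 s1'); rewrite -powRrM divff ?gt_eqF// powRr1// powR1.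
rewrite mulr1 mul1r (addrC s) subrK => /(_ erefl); lra.
Qed.

(** For [r >= 1] the inequality is the previous one at the point [t^r], with the
    exponent [1/r]. *)
Lemma powR_bernoulli_ge t r : 0 <= t -> 1 <= r -> 1 + r * (t - 1) <= t `^ r.
Proof.
move=> t0 r1; have r0 : 0 < r by lra.
have := @powR_bernoulli_le (t `^ r) r^-1 (powR_ge0 _ _).
rewrite invr_gt0 r0 invf_le1// r1 => /(_ erefl erefl).
rewrite -powRrM divff ?gt_eqF// powRr1// => h.
have : r * t <= r * (1 + r^-1 * (t `^ r - 1)) by rewrite ler_pM2l.
rewrite mulrDr mulrA divff ?gt_eqF//; lra.
Qed.

(** For a negative exponent both [expR z >= 1 + z] and [ln t <= t - 1] point in
    the right direction. *)
Lemma powR_bernoulli_neg t r : 0 < t -> r <= 0 -> 1 + r * (t - 1) <= t `^ r.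
Proof.
move=> t0 r0; rewrite /powR gt_eqF//.
apply: le_trans (expR_ge1Dx _).
rewrite lerD2l; apply: ler_wnM2l => //.
have -> : ln t = ln (1 + (t - 1)) by congr ln; ring.
by apply: le_ln1Dx; lra.
Qed.

(** Write [(a + b)^r = (a + b) (a + b)^(r - 1)] and use that the power [r - 1] is
    nonincreasing. *)
Lemma powR_subadd a b r : 0 <= a -> 0 <= b -> 0 < r -> r <= 1 ->
  (a + b) `^ r <= a `^ r + b `^ r.
Proof.
rewrite le_eqVlt => /predU1P[<-|a0]; first by rewrite add0r lerDr powR_ge0.
rewrite le_eqVlt => /predU1P[<-|b0]; first by rewrite addr0 lerDl powR_ge0.
move=> r0 r1; have ab : 0 < a + b by lra.
rewrite -(mulr_powRB1 (ltW ab))// mulrDl.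
have le_neg x y : 0 < x -> x <= y -> y `^ (r - 1) <= x `^ (r - 1).
  move=> x0 xy; rewrite -opprB !powRN lef_pV2 ?posrE ?powR_gt0//; last by lra.
  by apply: ge0_ler_powR; rewrite ?nnegrE; lra.
by apply: lerD; [rewrite -[leRHS](mulr_powRB1 (ltW a0))//|
  rewrite -[leRHS](mulr_powRB1 (ltW b0))//]; rewrite ler_pM2l//; apply: le_neg => //; lra.
Qed.

Lemma powR_concave_tangent x c q : 0 <= x -> 0 < c -> 0 < q -> q <= 1 ->
  x `^ q <= c `^ q + q * c `^ (q - 1) * (x - c).
Proof.
move=> x0 c0 q0 q1.
have -> : x = c * (x / c) by rewrite mulrCA divff ?gt_eqF ?mulr1.
have xc0 : 0 <= x / c by rewrite divr_ge0// ltW.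
rewrite powRM ?(ltW c0)//.
rewrite (_ : _ + _ = c `^ q * (1 + q * (x / c - 1))).
  by rewrite ler_wpM2l ?powR_ge0// powR_bernoulli_le.
rewrite -(mulr_powRB1 (ltW c0) q0); ring.
Qed.

Lemma powR_convex_tangent x c q : 0 <= x -> 0 <= c -> 1 <= q ->
  c `^ q + q * c `^ (q - 1) * (x - c) <= x `^ q.
Proof.
move=> x0 + q1; rewrite le_eqVlt => /predU1P[<-|c0].
  rewrite subr0 powR0 ?gt_eqF//; last by lra.
  have [->|q1'] := eqVneq q 1.
    by rewrite subrr powRr0 powRr1//; lra.
  by rewrite powR0 ?subr_eq0// mulr0 mul0r addr0 powR_ge0.
have -> : x = c * (x / c) by rewrite mulrCA divff ?gt_eqF ?mulr1.
have xc0 : 0 <= x / c by rewrite divr_ge0// ltW.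
rewrite [leRHS]powRM ?(ltW c0)//.
rewrite (_ : _ + _ = c `^ q * (1 + q * (x / c - 1))).
  by rewrite ler_wpM2l ?powR_ge0// powR_bernoulli_ge.
have q0 : 0 < q by lra.
rewrite -(mulr_powRB1 (ltW c0) q0); ring.
Qed.

(** Powers are Hoelder continuous on [0, 4 S], with exponent [min r 1]:
    subadditivity gives the case [r <= 1], the tangent inequality the case
    [1 < r].  The scale [S] is kept explicit because it will be the integration
    variable [|x|^2 + |y|^2]. *)
Lemma powR_holder r : 0 < r -> exists K e : R, [/\ 0 <= K, 0 < e, e <= 1 &
  forall a b S t, 0 <= a -> 0 <= b -> 0 <= t -> a <= 4 * S -> b <= 4 * S ->
    `|a - b| <= 2 * t * S -> t <= 1 ->
    `|a `^ r - b `^ r| <= K * t `^ e * S `^ r].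
Proof.
move=> r0; have [r1|r1] := leP r 1.
  exists 2, r; split => // a b S t.
  wlog ba : a b / b <= a => [H|a0 b0 t0 aS bS abt t1].
    move=> a0 b0 t0 aS bS abt t1; have [ba|/ltW ab] := leP b a; first exact: H.
    by rewrite distrC; apply: H => //; rewrite distrC.
  have S0 : 0 <= S by lra.
  have ba' : b `^ r <= a `^ r by apply: ge0_ler_powR; rewrite ?nnegrE; lra.
  rewrite ger0_norm ?subr_ge0//.
  have := @powR_subadd b (a - b) r b0; rewrite subr_ge0 ba => /(_ erefl r0 r1).
  rewrite (addrC b) subrK => h.
  have : (a - b) `^ r <= (2 * t * S) `^ r.
    move: abt; rewrite ger0_norm ?subr_ge0// => abt.
    by apply: ge0_ler_powR; rewrite ?nnegrE ?subr_ge0 ?mulr_ge0//; lra.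
  rewrite !powRM ?mulr_ge0// => h2.
  have h3 : (2:R) `^ r <= 2.
    by have := @ler_powR R 2 _ r 1 r1; rewrite powRr1//; apply; lra.
  have : 2 `^ r * (t `^ r * S `^ r) <= 2 * (t `^ r * S `^ r).
    by rewrite ler_wpM2r// mulr_ge0 ?powR_ge0.
  lra.
exists (r * 4 `^ (r - 1) * 2), 1; split => //; first by rewrite !mulr_ge0 ?powR_ge0; lra.
move=> a b S t.
wlog ba : a b / b <= a => [H|a0 b0 t0 aS bS abt t1].
  move=> a0 b0 t0 aS bS abt t1; have [ba|/ltW ab] := leP b a; first exact: H.
  by rewrite distrC; apply: H => //; rewrite distrC.
have S0 : 0 <= S by lra.
have ba' : b `^ r <= a `^ r by apply: ge0_ler_powR; rewrite ?nnegrE; lra.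
move: abt; rewrite !ger0_norm ?subr_ge0// => abt.
have := powR_convex_tangent b0 a0 (ltW r1) => h.
have h2 : a `^ (r - 1) <= 4 `^ (r - 1) * S `^ (r - 1).
  by rewrite -powRM//; apply: ge0_ler_powR; rewrite ?nnegrE; lra.
have h3 : r * a `^ (r - 1) * (a - b) <= r * (4 `^ (r - 1) * S `^ (r - 1)) * (2 * t * S).
  apply: ler_pM => //; rewrite ?mulr_ge0 ?powR_ge0 ?subr_ge0//; try lra.
  by rewrite ler_pM2l.
rewrite powRr1// -(mulr_powRB1 S0 r0); lra.
Qed.

End powR_inequalities.

(** The pointwise estimate behind the upper bound of the dilated energies.  With
    [d], [X], [Y], [S] standing for [|x - y|^2], [|x - l y|^2], [|l x - y|^2] and
    [|x|^2 + |y|^2], the numbers [X] and [Y] deviate from [l d] by a first-order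
    amount each, but their sum only by a second-order amount.
    For [q <= 1] concavity bounds [X^q + Y^q] by twice the power of the mean
    [l d + h], where [h] is of order [(1 - l)^2 S]; interpolating between
    [h^q] and [d^(q - 1) h], the increment of that power is at most a multiple
    of [d^(q - t) h^t] with [t = (1 + q)/2], which makes the power of [1 - l]
    larger than one while keeping the singularity [d^(-g)] weak.
    For [1 < q] the tangents at [X] and at [Y] differ from the tangent at [l d]
    by the Hoelder continuity of the derivative, and no singularity appears. *)
Lemma powR_second_difference (R : realType) (q : R) : 0 < q ->
  exists C e g : R, [/\ 0 <= C, 0 < e, 0 <= g, g < 2^-1 &
  forall l d S X Y, 2^-1 <= l -> l <= 3 / 2 -> 0 < d -> 0 <= X -> 0 <= Y ->
    d <= 2 * S -> X + Y = 2 * l * d + (1 - l) ^+ 2 * S ->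
    `|X - l * d| <= 2 * `|1 - l| * S -> `|Y - l * d| <= 2 * `|1 - l| * S ->
    X `^ q + Y `^ q <= 2 * l `^ q * d `^ q +
      C * `|1 - l| `^ (1 + e) * (d `^ (- g) * S `^ (q + g))].
Proof.
move=> q0; have [q1|q1] := leP q 1.
  exists 8, q, ((1 - q) / 2); split => //; try lra.
  move=> l d S X Y l1 l2 d0 X0 Y0 dS XY _ _.
  set t := q + (1 - q) / 2.
  have S0 : 0 < S by lra.
  set h := (1 - l) ^+ 2 * (S / 2); set Z := l * d.
  have Z0 : 0 < Z by rewrite mulr_gt0//; lra.
  have h0 : 0 <= h by rewrite mulr_ge0 ?sqr_ge0//; lra.
  have M0 : 0 < Z + h by lra.
  have concave : X `^ q + Y `^ q <= 2 * (Z + h) `^ q.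
    have := powR_concave_tangent X0 M0 q0 q1; have := powR_concave_tangent Y0 M0 q0 q1.
    set c := q * _ => hY hX.
    have : c * (X - (Z + h)) + c * (Y - (Z + h)) = 0.
      rewrite -mulrDr.
      have -> : X - (Z + h) + (Y - (Z + h)) = X + Y - 2 * (Z + h) by ring.
      by rewrite XY /Z /h; field.
    lra.
  (* the increment is at most [Z^(q - 1) h] if [h <= Z] and [2 h^q] otherwise *)
  have interp : (Z + h) `^ q <= Z `^ q + 2 * (Z `^ (q - t) * h `^ t).
    have [hZ|Zh] := leP h Z.
      have -> : Z + h = Z * (1 + h / Z).
        by rewrite mulrDr mulr1 mulrCA divff ?mulr1// gt_eqF.
      have s0 : 0 <= h / Z by rewrite divr_ge0// ltW.
      rewrite powRM ?(ltW Z0)//; last by lra.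
      have := @powR_bernoulli_le R (1 + h / Z) q.
      rewrite (addrC 1) addrK => /(_ _ q0 q1) bern.
      have {}bern : (h / Z + 1) `^ q <= 1 + (h / Z) `^ t.
        apply: le_trans (bern _) _; first by lra.
        rewrite lerD2l; apply: (@le_trans _ _ (h / Z)).
          by rewrite -[leRHS]mul1r ler_wpM2r.
        have [s0'|s0'] := eqVneq (h / Z) 0; first by rewrite s0' powR_ge0.
        apply: ger1_powR; last by rewrite /t; lra.
        by rewrite lt_neqAle eq_sym s0' s0 /= ler_pdivrMr// mul1r.
      apply: (@le_trans _ _ (Z `^ q * (1 + (h / Z) `^ t))).
        by rewrite ler_wpM2l ?powR_ge0.
      rewrite mulrDr mulr1 lerD2l (@powRM _ h Z^-1) ?invr_ge0 ?(ltW Z0)//.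
      rewrite -(powR_inv1 (ltW Z0)) -powRrM mulN1r mulrCA -powRD; last first.
        by apply/implyP => _; rewrite gt_eqF.
      rewrite (mulrC (h `^ t)).
      have : 0 <= Z `^ (q - t) * h `^ t by rewrite mulr_ge0 ?powR_ge0.
      lra.
    have h0' : 0 < h by lra.
    have h2 : (Z + h) `^ q <= 2 * h `^ q.
      apply: (@le_trans _ _ ((2 * h) `^ q)).
        by apply: ge0_ler_powR; rewrite ?nnegrE; lra.
      rewrite (@powRM _ 2 h)//.
      rewrite ler_wpM2r ?powR_ge0//.
      by have := @ler_powR R 2 _ q 1 q1; rewrite powRr1//; apply; lra.
    have h3 : h `^ q <= Z `^ (q - t) * h `^ t.
      have -> : h `^ q = h `^ (q - t) * h `^ t.
        by rewrite -powRD ?subrK//; apply/implyP => _; rewrite gt_eqF.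
      rewrite ler_wpM2r ?powR_ge0//.
      rewrite -opprB !powRN lef_pV2 ?posrE ?powR_gt0//.
      by apply: ge0_ler_powR; rewrite ?nnegrE /t; lra.
    have : 0 <= Z `^ q by exact: powR_ge0.
    lra.
  have hZ : Z `^ (q - t) <= 2 * d `^ (- ((1 - q) / 2)).
    rewrite (_ : q - t = - ((1 - q) / 2)); last by rewrite /t; ring.
    rewrite /Z powRM; [|lra|lra]; rewrite ler_wpM2r ?powR_ge0//.
    rewrite powRN -[leRHS]invrK lef_pV2 ?posrE ?powR_gt0//; try lra.
    have l12 : (2^-1 : R) `^ ((1 - q) / 2) <= l `^ ((1 - q) / 2).
      by apply: ge0_ler_powR; rewrite ?nnegrE; lra.
    apply: le_trans l12.
    by apply: ger1_powR; lra.
  have hh : h `^ t <= `|1 - l| `^ (1 + q) * S `^ t.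
    rewrite /h powRM ?sqr_ge0//; last by lra.
    rewrite -real_normK ?num_real// -powR_mulrn// -powRrM.
    rewrite (_ : 2%:R * t = 1 + q); last by rewrite /t; field.
    rewrite ler_wpM2l ?powR_ge0//.
    by apply: ge0_ler_powR; rewrite ?nnegrE /t; lra.
  have ZE : Z `^ q = l `^ q * d `^ q by rewrite /Z powRM//; lra.
  have : Z `^ (q - t) * h `^ t <=
     2 * d `^ (- ((1 - q) / 2)) * (`|1 - l| `^ (1 + q) * S `^ t).
    by apply: ler_pM => //; exact: powR_ge0.
  rewrite -/t; lra.
have r0 : 0 < q - 1 by lra.
have [K [e [K0 e0 e1 holder]]] := powR_holder r0.
exists (q * (4 `^ (q - 1) + 4 * K)), e, 0; split => //; first by
  rewrite mulr_ge0 ?addr_ge0 ?mulr_ge0 ?powR_ge0//; lra.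
move=> l d S X Y l1 l2 d0 X0 Y0 dS XY.
set t := `|1 - l|; set Z := l * d => XZ YZ.
have t0 : 0 <= t by exact: normr_ge0.
have t1 : t <= 1 by rewrite /t ler_norml; apply/andP; split; lra.
have S0 : 0 < S by lra.
have l0 : 0 < l by lra.
have Z0 : 0 < Z by rewrite mulr_gt0.
have ZS : Z <= 3 * S.
  apply: (@le_trans _ _ (3 / 2 * (2 * S))); last by lra.
  by apply: ler_pM => //; lra.
have tS : 2 * t * S <= 1 * S.
  rewrite ler_pM2r//.
  have : t <= 2^-1 by rewrite /t ler_norml; apply/andP; split; lra.
  lra.
have XS : X <= 4 * S by move: XZ; rewrite ler_norml => /andP[]; lra.
have YS : Y <= 4 * S by move: YZ; rewrite ler_norml => /andP[]; lra.
have ZS' : Z <= 4 * S by lra.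
have hX := powR_convex_tangent (ltW Z0) X0 (ltW q1).
have hY := powR_convex_tangent (ltW Z0) Y0 (ltW q1).
have HX := holder _ _ _ _ X0 (ltW Z0) t0 XS ZS' XZ t1.
have HY := holder _ _ _ _ Y0 (ltW Z0) t0 YS ZS' YZ t1.
set r := q - 1 in hX hY HX HY *.
have prodle (A B : R) : `|A| <= K * t `^ e * S `^ r -> `|B| <= 2 * t * S ->
    A * B <= K * t `^ e * S `^ r * (2 * t * S).
  move=> hA hB; apply: le_trans (ler_norm _) _; rewrite normrM.
  by apply: ler_pM => //.
have PX := prodle _ _ HX XZ; have PY := prodle _ _ HY YZ.
have te : t `^ (1 + e) = t * t `^ e.
  by rewrite powRD ?powRr1//; apply/implyP; rewrite gt_eqF// addr_gt0.
have Sq : S `^ (q + 0) = S * S `^ r by rewrite addr0 mulr_powRB1// ltW.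
have ZE : Z `^ q = l `^ q * d `^ q by rewrite /Z powRM// ltW.
have tt : t ^+ 2 <= t * t `^ e.
  rewrite expr2 ler_wpM2l//.
  have [->|t0'] := eqVneq t 0; first exact: powR_ge0.
  by apply: ger1_powR => //; rewrite lt_neqAle eq_sym t0' t0.
have ZX : Z `^ r * (t ^+ 2 * S) <= 4 `^ r * S `^ r * (t * t `^ e * S).
  apply: ler_pM; rewrite ?powR_ge0 ?mulr_ge0 ?sqr_ge0 ?(ltW S0)//.
    rewrite -powRM ?(ltW S0)//.
    by apply: ge0_ler_powR; rewrite ?nnegrE ?(ltW Z0) ?(ltW r0)// mulr_ge0 ?(ltW S0).
  by rewrite ler_pM2r.
have t2 : t ^+ 2 = (1 - l) ^+ 2 by rewrite /t real_normK ?num_real.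
have XYE : X - Z + (Y - Z) = t ^+ 2 * S.
  have -> : X - Z + (Y - Z) = X + Y - 2 * l * d by rewrite /Z; ring.
  by rewrite XY t2; ring.
have sumE : X `^ r * (X - Z) + Y `^ r * (Y - Z) =
  (X `^ r - Z `^ r) * (X - Z) + (Y `^ r - Z `^ r) * (Y - Z) + Z `^ r * (t ^+ 2 * S).
  by rewrite -XYE; ring.
have bound : X `^ r * (X - Z) + Y `^ r * (Y - Z) <=
   (4 `^ r + 4 * K) * (t * t `^ e) * (S * S `^ r) 
  by rewrite sumE; clear - PX PY ZX; lra.
have : q * (X `^ r * (X - Z) + Y `^ r * (Y - Z)) <=
   q * ((4 `^ r + 4 * K) * (t * t `^ e) * (S * S `^ r)) by rewrite ler_pM2l.
rewrite oppr0 powRr0 mul1r te Sq.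
clear - hX hY ZE; lra.
Qed.

(** * A one-sided criterion for a vanishing derivative *)

(** A lower bound of order higher than one prevents a nonzero slope: an
    increment against the slope would make [G] negative to first order. *)
Lemma derive_eq0_of_lower_bound (R : realType) (G : R -> R) (D C e : R) :
  0 <= C -> 0 < e -> is_derive (1:R) 1 G D -> G 1 = 0 ->
  (forall l, 2^-1 <= l -> l <= 3 / 2 -> - (C * `|1 - l| `^ (1 + e)) <= G l) ->
  D = 0.
Proof.
move=> C0 e0 [dG GD] G1 GC; apply/eqP/negPn/negP => D0.
have D2 : 0 < `|D| / 2 by rewrite divr_gt0// normr_gt0.
have [del del0 hdel] : exists2 del : R, 0 < del & forall h, 0 < `|h| -> `|h| < del ->
    `|h^-1 * G (1 + h) - D| < `|D| / 2.
  have /cvgr_dist_lt/(_ _ D2) :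
      h^-1 *: ((G \o shift 1) (h *: 1) - G 1) @[h --> 0^'] --> D.
    by rewrite -GD; exact: dG.
  rewrite near_withinE => /nbhs_ballP[/= del del0 hdel]; exists del => // h h0 hd.
  have hb : ball (0 : R) del h by rewrite /ball /= sub0r normrN.
  have := hdel h hb; rewrite -normr_gt0 => /(_ h0).
  by rewrite G1 subr0 distrC [h%:A]mulr1 (addrC h 1).
(* for increments up to [r] the bound [C h^e] on the slope is at most [|D| / 2] *)
pose r := (`|D| / 2 / (C + 1)) `^ (e^-1).
have r0 : 0 < r by rewrite powR_gt0// divr_gt0//; lra.
pose h0 := Num.min (del / 2) (Num.min r 2^-1).
have h0p : 0 < h0 by rewrite !lt_min r0 divr_gt0//= invr_gt0 ltr0n.
have h0d : h0 < del by apply: (@le_lt_trans _ _ (del / 2)); [rewrite /h0 ge_min lexx|lra].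
have h0r : h0 <= r by rewrite /h0 ge_min ge_min lexx /= orbT.
have h02 : h0 <= 2^-1 by rewrite /h0 !ge_min lexx !orbT.
have small : C * h0 `^ e <= `|D| / 2.
  apply: (@le_trans _ _ (C * (`|D| / 2 / (C + 1)))).
    rewrite ler_wpM2l//.
    have : h0 `^ e <= r `^ e by apply: ge0_ler_powR; rewrite ?nnegrE; lra.
    rewrite /r -powRrM mulVf ?gt_eqF// powRr1//.
    by rewrite divr_ge0//; lra.
  rewrite mulrCA ler_piMr ?(ltW D2)//.
  by rewrite ler_pdivrMr; lra.
have pe : h0 `^ (1 + e) = h0 * h0 `^ e.
  by rewrite powRD ?powRr1 ?(ltW h0p)//; apply/implyP => _; rewrite gt_eqF.
(* the sign of the increment is chosen so that it opposes the slope *)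
have [Dneg|Dpos] := ltP D 0.
  have := hdel h0; rewrite gtr0_norm// => /(_ h0p h0d).
  have := GC (1 + h0); rewrite opprD addrA subrr sub0r normrN gtr0_norm// pe.
  have l1 : 2^-1 <= 1 + h0 by lra.
  have l2 : 1 + h0 <= 3 / 2 by lra.
  move=> /(_ l1 l2) lb.
  have : - (C * h0 `^ e) <= h0^-1 * G (1 + h0).
    by rewrite ler_pdivlMl//; lra.
  rewrite ltr0_norm// in small *.
  move=> lb2; rewrite ltr_norml => /andP[_]; lra.
have {}Dpos : 0 < D by rewrite lt_neqAle eq_sym D0.
have := hdel (- h0); rewrite normrN gtr0_norm// => /(_ h0p h0d).
have := GC (1 - h0); rewrite opprB addrCA subrr addr0 gtr0_norm// pe.
have l1 : 2^-1 <= 1 - h0 by lra.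
have l2 : 1 - h0 <= 3 / 2 by lra.
move=> /(_ l1 l2) lb.
have : (- h0)^-1 * G (1 - h0) <= C * h0 `^ e.
  by rewrite invrN mulNr -mulrN ler_pdivrMl//; lra.
rewrite gtr0_norm// in small *.
move=> lb2; rewrite ltr_norml => /andP[+ _]; lra.
Qed.

(** * Lebesgue measure on row vectors *)

Lemma measurable_rV_box (R : realType) (n : nat)
    (A : 'I_n -> set (measurableTypeR R)) :
  (forall i, measurable (A i)) ->
  measurable [set x : 'rV[R]_n | forall i, A i (x ord0 i)].
Proof.
move=> mA.
rewrite (_ : [set _ | _] = \bigcap_(i in [set: 'I_n])
   ((fun x : 'rV[R]_n => x ord0 i : measurableTypeR R) @^-1` A i)); last first.
  by apply/seteqP; split => [x Hx i _|x Hx i]; exact: Hx.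
apply: fin_bigcap_measurable => // i _.
by rewrite -[X in measurable X]setTI; apply: measurable_coord => //; exact: mA.
Qed.

(** The sigma-algebra generated by the coordinates contains the topology: an open
    set is a countable union of boxes with rational centers and radii [1/(k + 1)]. *)
Lemma open_measurable_rV (R : realType) (n : nat) (U : set 'rV[R]_n) :
  open U -> measurable U.
Proof.
move=> oU.
pose B (p : 'rV[rat]_n * nat) : set 'rV[R]_n := [set x : 'rV[R]_n |
  forall i, `](ratr (p.1 ord0 i) - p.2.+1%:R^-1),
              (ratr (p.1 ord0 i) + p.2.+1%:R^-1)[%classic (x ord0 i)].
have mB p : measurable (B p).
  by apply: (@measurable_rV_box R n (fun i => _)) => i; exact: measurable_itv.
rewrite (_ : U = \bigcup_p (if `[< B p `<=` U >] then B p else set0)).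
  by apply: countable_bigcupT_measurable => [|p]; [exact: countableP|case: ifP].
apply/seteqP; split=> [x Ux|x [p _]]; last first.
  by case: ifPn => // /asboolP; exact.
have : nbhs x U by rewrite nbhsE; exists U.
rewrite -nbhs_ballE => -[/= e e0 xeU].
have [k _ /(_ k (leqnn _)) /= ke] :=
  near_infty_natSinv_lt (PosNum (divr_gt0 e0 (ltr0n R 2))).
have k0 : (0 < k.+1%:R^-1 :> R) by rewrite invr_gt0.
move: ke k0; set d : R := k.+1%:R^-1 => ke k0.
have /choice[c cP] i : exists q : rat, `|x ord0 i - ratr q| < d.
  have /rat_in_itvoo[q] : x ord0 i - d < x ord0 i + d by lra.
  rewrite in_itv/= => /andP[q1 q2]; exists q; rewrite ltr_norml; apply/andP; split; lra.
exists (\row_i c i, k) => //; rewrite ifT; last first.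
  apply/asboolP => y By; apply: xeU; split => // i j.
  rewrite ord1.
  have := By j; rewrite /B /= -/d mxE in_itv/= => /andP[y1 y2].
  have := cP j; rewrite ltr_norml => /andP[c1 c2].
  rewrite /ball /= ltr_norml; apply/andP; split; lra.
move=> i; rewrite /= -/d mxE in_itv/=; have := cP i; rewrite ltr_norml => /andP[c1 c2].
apply/andP; split; lra.
Qed.

Lemma continuous_measurable_rV (R : realType) (n : nat) (D : set 'rV[R]_n)
    (f : 'rV[R]_n -> R) : open D -> (forall x, D x -> {for x, continuous f}) ->
  measurable_fun D (f : 'rV[R]_n -> measurableTypeR R).
Proof.
move=> oD cf; apply: (measurability _ (measurable_realfun.RGenOpens.measurableE R)).
move=> _ [_ [a [b ->] <-]]; apply: open_measurable_rV.
rewrite openE => x /= [Dx fx]; rewrite /interior.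
apply: filterI; first by rewrite nbhsE; exists D.
apply: (cf _ Dx); apply: open_nbhs_nbhs; split => //; exact: interval_open.
Qed.

Lemma measurable_scale_rV (R : realType) (n : nat) (l : R) :
  measurable_fun [set: 'rV[R]_n] (fun x : 'rV[R]_n => l *: x).
Proof.
apply: measurable_fun_rV => i.
rewrite [X in measurable_fun _ X](_ : _ = fun x : 'rV[R]_n => l * x ord0 i).
  by apply: measurable_funM => //; exact: measurable_coord.
by apply/funext => x; rewrite mxE.
Qed.

(** By uniqueness of Lebesgue measure it suffices to compare the measures of
    half-open intervals. *)
Lemma ge0_integral_scale1 (R : realType) (l : R) (F : R -> \bar R) : 0 < l ->
  measurable_fun [set: measurableTypeR R] F -> (forall x, (0 <= F x)%E) ->
  (\int[@lebesgue_measure R]_t F (l * t)%R =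
   l^-1%:E * \int[@lebesgue_measure R]_t F t)%E.
Proof.
move=> l0 mF F0.
have ml : measurable_fun [set: measurableTypeR R]
    ((fun t => l * t) : measurableTypeR R -> measurableTypeR R).
  exact: measurable_funM.
pose nu : {measure set (measurableTypeR R) -> \bar R} :=
  measure_function_pushforward__canonical__measure_function_Measure
    (@lebesgue_measure R) ml.
have nuE A : measurable A -> lebesgue_measure A =
    mscale (NngNum (ltW l0)) nu A.
  move=> mA.
  apply: (@lebesgue_measure_unique R (mscale (NngNum (ltW l0)) nu)) => // _ [[a b]] _ <-.
  transitivity
    (l%:E * lebesgue_measure ((fun t : R => (l * t)%R) @^-1` `]a, b]))%E => //.
  rewrite (_ : _ @^-1` _ = `](l^-1 * a), (l^-1 * b)]%classic); last first.
    apply/seteqP; split => t /=; rewrite !in_itv/= => /andP[h1 h2]; apply/andP.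
      by rewrite ltr_pdivrMl// ler_pdivlMl.
    by rewrite -ltr_pdivrMl// -ler_pdivlMl.
  rewrite !lebesgue_measure_itv/= !lte_fin ltr_pM2l ?invr_gt0//.
  case: ifPn => _; last by rewrite mule0.
  by rewrite -!EFinB -EFinM -mulrBr mulrA divff ?gt_eqF// mul1r.
rewrite [in RHS](eq_measure_integral (mscale (NngNum (ltW l0)) nu)); last first.
  by move=> A mA _; exact: nuE.
rewrite ge0_integral_mscale//= muleA -EFinM mulVf ?gt_eqF// mul1e.
by rewrite ge0_integral_pushforward.
Qed.

Lemma integral_lebesgue_rVS (R : realType) (n : nat) (F : 'rV[R]_n.+1 -> \bar R) :
  measurable_fun [set: 'rV[R]_n.+1] F -> (forall x, (0 <= F x)%E) ->
  (\int[lebesgue_rV R n.+1]_x F x =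
   \int[lebesgue_rV R n]_x \int[@lebesgue_measure R]_t F (snoc x t))%E.
Proof.
move=> mF F0.
have mF' : measurable_fun setT (fun p : 'rV[R]_n * measurableTypeR R => F (snoc p.1 p.2)).
  exact: (measurableT_comp mF (measurable_snoc (n := n))).
rewrite -(fubini_tonelli1 (fun p : 'rV[R]_n * measurableTypeR R => F (snoc p.1 p.2)))//.
rewrite /= /lebesgue_step.
exact: (ge0_integral_pushforward (measurable_snoc (n := n))).
Qed.

Lemma scale_snoc (R : realType) (n : nat) (l : R) (x : 'rV[R]_n) (t : R) :
  l *: snoc x t = snoc (l *: x) (l * t).
Proof. by apply/rowP => i; rewrite !mxE; case: unlift => [j|//]; rewrite !mxE. Qed.

Lemma ge0_integral_scale_rV (R : realType) (n : nat) (l : R)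
    (F : 'rV[R]_n -> \bar R) : 0 < l ->
  measurable_fun [set: 'rV[R]_n] F -> (forall x, (0 <= F x)%E) ->
  (\int[lebesgue_rV R n]_x F (l *: x)%R =
   (l ^- n)%:E * \int[lebesgue_rV R n]_x F x)%E.
Proof.
move=> l0; elim: n F => [|n IH] F mF F0.
  rewrite expr0 invr1 mul1e; apply: eq_integral => x _; congr F.
  by apply/rowP => -[].
have mFS : measurable_fun setT (fun p : 'rV[R]_n * measurableTypeR R => F (snoc p.1 p.2)).
  exact: (measurableT_comp mF (measurable_snoc (n := n))).
have mH := measurable_fun_fubini_tonelli_F (m2 := @lebesgue_measure R) _ mFS
   (fun p => F0 (snoc p.1 p.2)).
rewrite !integral_lebesgue_rVS//; last first.
  exact: (measurableT_comp mF (measurable_scale_rV l)).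
transitivity (\int[lebesgue_rV R n]_x (l^-1%:E *
   \int[@lebesgue_measure R]_t F (snoc (l *: x) t)))%E.
  apply: eq_integral => x _.
  rewrite -(@ge0_integral_scale1 _ l (fun t => F (snoc (l *: x) t)))//.
    by apply: eq_integral => t _; rewrite scale_snoc.
  apply: (measurableT_comp mF); apply: measurable_fun_rV => i.
  rewrite [X in measurable_fun _ X](_ : _ = fun t : R =>
    if unlift ord_max i is Some j then (l *: x) ord0 j else t).
    by case: unlift => [j|].
  by apply/funext => t; rewrite mxE.
rewrite ge0_integralZl_EFin; last 4 first.
- exact: measurableT.
- by move=> x _; exact: integral_ge0.
- exact: (measurableT_comp mH (measurable_scale_rV l)).
- by rewrite invr_ge0 ltW.
rewrite (IH (fun x => \int[@lebesgue_measure R]_t F (snoc x t))%E)//; last first.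
  by move=> x; exact: integral_ge0.
by rewrite muleA -EFinM exprS invfM.
Qed.

(** * The squared Euclidean norm *)

Definition nsq (R : realType) (n : nat) (x : 'rV[R]_n) : R :=
  \sum_(i < n) x ord0 i ^+ 2.

Section squared_norm.
Variables (R : realType) (n : nat).
Implicit Types (x w : 'rV[R]_n) (l q : R).

Lemma nsq_ge0 x : 0 <= nsq x.
Proof. by apply: sumr_ge0 => i _; exact: sqr_ge0. Qed.

Lemma coord_le_nsq x i : x ord0 i ^+ 2 <= nsq x.
Proof.
rewrite /nsq (bigD1 i)//= lerDl; apply: sumr_ge0 => j _; exact: sqr_ge0.
Qed.

Lemma enorm_powR x q : enorm x `^ q = nsq x `^ (q / 2).
Proof.
by rewrite /enorm -/(nsq x) -powR12_sqrt ?nsq_ge0// -powRrM mulrC.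
Qed.

(** The cross terms of the two squares add up to those of [2 l |x - w|^2]: the
    sum has no further term of first order in [1 - l]. *)
Lemma nsq_dilD l x w : nsq (x - l *: w) + nsq (l *: x - w) =
  2 * l * nsq (x - w) + (1 - l) ^+ 2 * (nsq x + nsq w).
Proof.
rewrite /nsq mulrDr !mulr_sumr -!big_split /=; apply: eq_bigr => i _.
rewrite !mxE; ring.
Qed.

Lemma nsq_dilB1 l x w : nsq (x - l *: w) - l * nsq (x - w) =
  (1 - l) * (nsq x - l * nsq w).
Proof.
rewrite /nsq !mulr_sumr -!sumrB !mulr_sumr; apply: eq_bigr => i _.
rewrite !mxE; ring.
Qed.

Lemma nsq_dilB2 l x w : nsq (l *: x - w) - l * nsq (x - w) =
  (1 - l) * (nsq w - l * nsq x).
Proof.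
rewrite /nsq !mulr_sumr -!sumrB !mulr_sumr; apply: eq_bigr => i _.
rewrite !mxE; ring.
Qed.

Lemma nsq_quasi_triangle x w : nsq x <= 2 * (nsq (x - w) + nsq w).
Proof.
rewrite /nsq mulrDr !mulr_sumr -big_split /=; apply: ler_sum => i _.
rewrite !mxE -subr_ge0 (_ : _ - _ = (x ord0 i - 2 * w ord0 i) ^+ 2); last ring.
exact: sqr_ge0.
Qed.

Lemma nsqN x : nsq (- x) = nsq x.
Proof. by apply: eq_bigr => i _; rewrite mxE sqrrN. Qed.

Lemma nsqB_le x w : nsq (x - w) <= 2 * (nsq x + nsq w).
Proof.
by have := nsq_quasi_triangle (x - w) (- w); rewrite opprK subrK nsqN.
Qed.

Lemma measurable_nsq d (T : measurableType d) (F : T -> 'rV[R]_n) :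
  (forall i, measurable_fun setT (fun t => F t ord0 i)) ->
  measurable_fun setT (fun t => nsq (F t)).
Proof.
move=> mF; apply: measurable_sum => i.
by apply: measurable_funX; exact: mF.
Qed.

End squared_norm.

Section flat_points.
Variables (R : realType) (n : nat).
Implicit Types (y : 'rV[R]_n) (x : 'rV[R]_n.+1).

Lemma snoc_lift y (t : R) i : snoc y t ord0 (lift ord_max i) = y ord0 i.
Proof. by rewrite mxE liftK. Qed.

Lemma snoc_max y (t : R) : snoc y t ord0 ord_max = t.
Proof. by rewrite mxE unlift_none. Qed.

Lemma nsq_split x :
  nsq x = nsq (\row_i x ord0 (lift ord_max i) : 'rV[R]_n) + lastc x ^+ 2.
Proof.
rewrite /nsq big_ord_recr /=; congr (_ + _); apply: eq_bigr => i _.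
by rewrite mxE; congr (x _ _ ^+ 2); apply/val_inj; rewrite /= /bump leqNgt ltn_ord.
Qed.

Lemma nsq_snoc0 y : nsq (snoc y 0) = nsq y.
Proof.
rewrite nsq_split /lastc snoc_max expr0n addr0; congr nsq.
by apply/rowP => i; rewrite mxE snoc_lift.
Qed.

Lemma nsqB_snoc0 x y : nsq (x - snoc y 0) =
  nsq (y - \row_i x ord0 (lift ord_max i)) + lastc x ^+ 2.
Proof.
rewrite nsq_split /lastc !mxE unlift_none subr0; congr (_ + _).
rewrite -nsqN; congr nsq; apply/rowP => i; rewrite !mxE liftK; ring.
Qed.

Lemma scale_snoc0 (l : R) y : snoc (l *: y) 0 = l *: snoc y 0.
Proof. by rewrite scale_snoc mulr0. Qed.

End flat_points.

Lemma measurable_nsqB d (T : measurableType d) (R : realType) (n : nat)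
    (F G : T -> 'rV[R]_n) :
  measurable_fun setT F -> measurable_fun setT G ->
  measurable_fun setT (fun t => nsq (F t - G t)).
Proof.
move=> mF mG; apply: measurable_nsq => i.
rewrite [X in measurable_fun _ X](_ : _ = fun t => F t ord0 i - G t ord0 i).
  by apply: measurable_funB; [exact: (measurableT_comp (measurable_coord i) mF)|
                              exact: (measurableT_comp (measurable_coord i) mG)].
by apply/funext => t; rewrite !mxE.
Qed.

(** * Local integrability of small negative powers *)

Lemma lebesgue_measure_cube (R : realType) (m : nat) (a : 'I_m -> R) (s : R) : 0 <= s ->
  lebesgue_rV R m [set y | forall i, `[a i, (a i + s)]%classic (y ord0 i)] =
  (s ^+ m)%:E.
Proof.
move=> s0.
rewrite (@lebesgue_rV_box R m (fun i => `[a i, a i + s]%classic)); last first.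
  by move=> i; exact: measurable_itv.
under eq_bigr => i _.
  rewrite lebesgue_measure_itv/= lte_fin.
  rewrite (_ : (if _ then _ else _) = s%:E); last first.
    case: ifPn => [_|]; first by rewrite -EFinB addrAC subrr add0r.
    by rewrite ltrDl -leNgt => s0'; congr EFin; apply/eqP; rewrite eq_le s0 s0'.
  over.
elim: m {a} => [|m IH]; first by rewrite big_ord0 expr0.
by rewrite big_ord_recr /= IH -EFinM exprSr.
Qed.

Lemma geometric_nneseries_le (R : realType) (a z : R) : 0 <= a -> 0 <= z -> z < 1 ->
  (\sum_(0 <= k <oo) (a * z ^+ k)%:E <= (a / (1 - z))%:E)%E.
Proof.
move=> a0 z0 z1; have z1' : 0 < 1 - z by lra.
apply: lime_le.
  by apply: is_cvg_nneseries => k _ _; rewrite lee_fin mulr_ge0// exprn_ge0.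
apply: nearW => k; rewrite sumEFin lee_fin.
have := @geometric_seriesE R a z; rewrite lt_eqF// => /(_ erefl).
move=> /(congr1 (fun f => f k)); rewrite /series /= => ->.
rewrite ler_pM2r ?invr_gt0// ler_piMr//.
by rewrite lerBlDr lerDl exprn_ge0.
Qed.

Lemma dyadic_scale (R : realType) (d s : R) : 0 < d -> d <= s ->
  exists k, s * 4^-1 ^+ k.+1 < d /\ d <= s * 4^-1 ^+ k.
Proof.
move=> d0 ds; have s0 : 0 < s by exact: lt_le_trans ds.
have ex : exists k, s * 4^-1 ^+ k.+1 < d.
  have [k _ /(_ k (leqnn _)) /= kd] :=
    near_infty_natSinv_expn_lt (PosNum (divr_gt0 d0 s0)).
  exists k; rewrite -ltr_pdivlMl// mulrC; apply: le_lt_trans kd.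
  rewrite mul1r -exprVn; apply: (@le_trans _ _ (4^-1 ^+ k)).
    by rewrite exprS ler_piMl ?exprn_ge0//; lra.
  by apply: lerXn2r; rewrite ?nnegrE; lra.
case: (ex_minnP ex) => k kd kmin; exists k; split => //.
case: k kd kmin => [|k] kd kmin; first by rewrite expr0 mulr1.
by rewrite leNgt; apply/negP => /kmin; rewrite ltnn.
Qed.

(** Split [d <= r^2] into the dyadic shells [r^2 4^(-k-1) < d <= r^2 4^(-k)]: each
    lies in a cube of side [2 r 2^(-k)], of volume a multiple of [r^m 2^(-k m)],
    and [d^(-g)] is there at most a multiple of [r^(-2 g) 4^(k g)].  The
    resulting series is geometric with ratio [4^g / 2^m < 1], since
    [2 g < 1 <= m].  The function [d] is only assumed to dominate the squared
    distance to [c], so that it can be the squared distance from a point of the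
    half-space lying above [c]. *)
Lemma singular_integral_le (R : realType) (m : nat) (g : R) : (0 < m)%N ->
  0 <= g -> g < 2^-1 ->
  exists2 C : R, 0 <= C & forall (c : 'rV[R]_m) (d : 'rV[R]_m -> R) (r : R),
    0 < r -> measurable_fun setT d -> (forall y, 0 < d y) ->
    (forall y, nsq (y - c) <= d y) ->
    (\int[lebesgue_rV R m]_y (if d y <= r ^+ 2 then d y `^ (- g) else 0)%:E
      <= (C * (r ^+ m * (r ^+ 2) `^ (- g)))%:E)%E.
Proof.
move=> m0 g0 g1; pose z : R := 2^-1 ^+ m * 4 `^ g.
have z0 : 0 <= z by rewrite mulr_ge0 ?exprn_ge0 ?powR_ge0.
have z1 : z < 1.
  apply: (@le_lt_trans _ _ (2^-1 * 4 `^ g)).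
    rewrite ler_wpM2r ?powR_ge0//.
    by rewrite -[leRHS]expr1 ler_wiXn2l//; lra.
  rewrite ltr_pdivrMl// mulr1.
  have -> : (2:R) = 4 `^ 2^-1.
    by rewrite powR12_sqrt// (_ : 4 = 2 ^+ 2) ?sqrtr_sqr ?ger0_norm//; ring.
  by rewrite /powR gt_eqF// ltr_expR ltr_pM2r// ln_gt0//; lra.
exists (2 ^+ m * 4 `^ g / (1 - z)).
  by rewrite divr_ge0 ?mulr_ge0 ?exprn_ge0 ?powR_ge0//; lra.
move=> c d r r0 md d0 cd.
pose s k : R := r * 2^-1 ^+ k.
have s0 k : 0 < s k by rewrite mulr_gt0// exprn_gt0.
pose Q k := [set y : 'rV[R]_m |
  forall i, `[c ord0 i - s k, (c ord0 i - s k) + 2 * s k]%classic (y ord0 i)].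
have mQ k : measurable (Q k).
  by apply: (@measurable_rV_box R m (fun i => _)) => i; exact: measurable_itv.
pose a k : R := (r ^+ 2 * 4^-1 ^+ k.+1) `^ (- g).
have a0 k : 0 <= a k by exact: powR_ge0.
apply: (@le_trans _ _ (\int[lebesgue_rV R m]_y
    \sum_(0 <= k <oo) ((a k)%:E * (\1_(Q k) y)%:E))%E).
  apply: ge0_le_integral => //.
  - by move=> y _; rewrite lee_fin; case: ifPn => // _; exact: powR_ge0.
  - apply/measurable_EFinP; apply: measurable_fun_ifT => //.
      by apply: measurable_fun_ler => //.
    exact: (measurableT_comp (measurable_powR (- g)) md).
  - apply: ge0_emeasurable_sum => k //.
      by move=> y _ _; rewrite mule_ge0 ?lee_fin.
    by move=> _; apply/measurable_EFinP; apply: measurable_funM.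
  - move=> y _; case: ifPn => [dr|_]; last first.
      by apply: nneseries_ge0 => k _ _; rewrite mule_ge0 ?lee_fin.
    have [k [k1 k2]] := dyadic_scale (d0 y) dr.
    have u0 i : (0 <= (a i)%:E * (\1_(Q i) y)%:E)%E by rewrite mule_ge0 ?lee_fin.
    apply: (@le_trans _ _
      (\sum_(0 <= i < k.+1) ((a i)%:E * (\1_(Q i) y)%:E))%E); last first.
      exact: nneseries_lim_ge.
    rewrite big_nat_recr//=; apply: le_trans (leeDr _ _); last first.
      by apply: sume_ge0 => i _.
    rewrite indicE mem_set ?mule1; last first.
      have : nsq (y - c) <= s k ^+ 2.
        apply: le_trans (cd y) (le_trans k2 _).
        rewrite /s exprMn ler_wpM2l ?sqr_ge0// -exprM mulnC exprM.
        by rewrite (_ : 2^-1 ^+ 2 = 4^-1)//; field.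
      move=> cs i; have := le_trans (coord_le_nsq _ i) cs.
      rewrite -[leLHS]real_normK ?num_real// ler_sqr ?nnegrE ?(ltW (s0 k))//.
      rewrite !mxE ler_norml /= in_itv/= => /andP[h1 h2].
      by apply/andP; split; lra.
    rewrite lee_fin /a !powRN lef_pV2 ?posrE ?powR_gt0//; last first.
      by rewrite mulr_gt0 ?exprn_gt0.
    apply: ge0_ler_powR => //; last exact: ltW.
      by rewrite nnegrE mulr_ge0 ?exprn_ge0 ?(ltW r0).
    by rewrite nnegrE ltW.
rewrite integral_nneseries//; last 2 first.
- by move=> k; apply/measurable_EFinP; apply: measurable_funM.
- by move=> k y _; rewrite mule_ge0 ?lee_fin.
have E k : (\int[lebesgue_rV R m]_x ((a k)%:E * (\1_(Q k) x)%:E) =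
   ((2 ^+ m * 4 `^ g * (r ^+ m * (r ^+ 2) `^ (- g))) * z ^+ k)%:E)%E.
  rewrite ge0_integralZl_EFin; last 4 first.
  - exact: measurableT.
  - by move=> y _; rewrite lee_fin.
  - exact/measurable_EFinP.
  - exact: a0.
  rewrite integral_indic// setIT [X in (_ * X)%E]lebesgue_measure_cube; last first.
    by rewrite mulr_ge0// ltW.
  rewrite -EFinM; congr EFin.
  rewrite /a /s powRM ?sqr_ge0 ?exprn_ge0//.
  have -> : (4^-1 ^+ k.+1 : R) `^ (- g) = 4 `^ g * (4 `^ g) ^+ k.
    rewrite -exprS exprVn -powR_inv1 ?exprn_ge0// -powRrM mulrNN mul1r.
    exact: powR_exprn.
  rewrite /z !exprMn -!exprM (mulnC k m); ring.
under eq_eseriesr do rewrite E.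
apply: le_trans (geometric_nneseries_le _ z0 z1) _.
  by rewrite !mulr_ge0 ?exprn_ge0 ?powR_ge0// ltW.
by rewrite lee_fin le_eqVlt; apply/orP; left; apply/eqP; ring.
Qed.

(** * Integrals of nonnegative real functions *)

Lemma ler_combination (R : realType) (a a1 a2 c1 c2 k : R) : 0 <= k ->
  a <= c1 * a1 + c2 * a2 -> a * k <= c1 * (a1 * k) + c2 * (a2 * k).
Proof. by move=> k0 h; rewrite !mulrA -mulrDl ler_wpM2r. Qed.

Lemma ler_weighted (R : realType) (w X Y c1 Z c2 W : R) : 0 <= w ->
  (0 < w -> X + Y <= c1 * Z + c2 * W) ->
  w * X + w * Y <= c1 * (w * Z) + c2 * (w * W).
Proof.
rewrite le_eqVlt => /predU1P[<- _|w0 /(_ w0) h].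
  by rewrite !mul0r !mulr0.
by rewrite -mulrDr ![_ * (w * _)]mulrCA -mulrDr ler_wpM2l// ltW.
Qed.

Section ge0_real_integrals.
Context d (T : measurableType d) (R : realType).
Variable mu : {measure set T -> \bar R}.
Implicit Types h : T -> R.

Lemma ge0_integral_le_combination h h1 h2 (c1 c2 a1 a2 : R) :
  measurable_fun setT h -> measurable_fun setT h1 -> measurable_fun setT h2 ->
  (forall x, 0 <= h x) -> (forall x, 0 <= h1 x) -> (forall x, 0 <= h2 x) ->
  0 <= c1 -> 0 <= c2 -> (forall x, h x <= c1 * h1 x + c2 * h2 x) ->
  (\int[mu]_x (h1 x)%:E <= a1%:E)%E -> (\int[mu]_x (h2 x)%:E <= a2%:E)%E ->
  (\int[mu]_x (h x)%:E <= (c1 * a1 + c2 * a2)%:E)%E.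
Proof.
move=> mh mh1 mh2 h_0 h10 h20 c10 c20 hle I1 I2.
have mE (k : T -> R) : measurable_fun setT k -> measurable_fun setT (fun x => (k x)%:E).
  by move=> mk; exact/measurable_EFinP.
apply: (@le_trans _ _ (\int[mu]_x (c1%:E * (h1 x)%:E + c2%:E * (h2 x)%:E))%E).
  apply: ge0_le_integral => //.
  - by move=> x _; rewrite lee_fin.
  - exact: mE.
  - rewrite [X in measurable_fun _ X](_ : _ = fun x => (c1 * h1 x + c2 * h2 x)%:E)//.
    by apply: mE; apply: measurable_funD; apply: measurable_funM.
  - by move=> x _; rewrite -!EFinM -EFinD lee_fin.
have m1 : measurable_fun setT (fun x => (c1%:E * (h1 x)%:E)%E).
  by apply: (mE (fun x => c1 * h1 x)); apply: measurable_funM.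
have m2 : measurable_fun setT (fun x => (c2%:E * (h2 x)%:E)%E).
  by apply: (mE (fun x => c2 * h2 x)); apply: measurable_funM.
rewrite ge0_integralD//; last 2 first.
- by move=> x _; rewrite mule_ge0 ?lee_fin.
- by move=> x _; rewrite mule_ge0 ?lee_fin.
rewrite !ge0_integralZl_EFin//; last 4 first.
- by move=> x _; rewrite lee_fin.
- exact: mE.
- by move=> x _; rewrite lee_fin.
- exact: mE.
by rewrite EFinD !EFinM leeD// lee_wpmul2l ?lee_fin.
Qed.

Lemma ge0_integral_le_multiple h h1 (c1 a1 : R) :
  measurable_fun setT h -> measurable_fun setT h1 ->
  (forall x, 0 <= h x) -> (forall x, 0 <= h1 x) ->
  0 <= c1 -> (forall x, h x <= c1 * h1 x) ->
  (\int[mu]_x (h1 x)%:E <= a1%:E)%E ->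
  (\int[mu]_x (h x)%:E <= (c1 * a1)%:E)%E.
Proof.
move=> mh mh1 h0 h10 c10 hle I1.
have -> : c1 * a1 = c1 * a1 + 0 * a1 by rewrite mul0r addr0.
by apply: (@ge0_integral_le_combination h h1 h1) => // x; rewrite mul0r addr0.
Qed.

Lemma ge0_integral_real h : (forall x, 0 <= h x) ->
  forall a, (\int[mu]_x (h x)%:E <= a%:E)%E ->
  exists2 I, 0 <= I & (\int[mu]_x (h x)%:E = I%:E)%E.
Proof.
move=> h0 a Ia.
have I0 : (0 <= \int[mu]_x (h x)%:E)%E by apply: integral_ge0 => x _; rewrite lee_fin.
exists (fine (\int[mu]_x (h x)%:E)%E); first exact: fine_ge0.
by rewrite fineK// ge0_fin_numE// (le_lt_trans Ia)// ltry.
Qed.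

Lemma ge0_integral_sum_real h1 h2 (a : R) :
  measurable_fun setT h1 -> measurable_fun setT h2 ->
  (forall x, 0 <= h1 x) -> (forall x, 0 <= h2 x) ->
  (\int[mu]_x (h1 x + h2 x)%:E <= a%:E)%E ->
  exists A B, [/\ (\int[mu]_x (h1 x)%:E = A%:E)%E,
    (\int[mu]_x (h2 x)%:E = B%:E)%E & A + B <= a].
Proof.
move=> mh1 mh2 h10 h20.
under eq_integral do rewrite EFinD.
have ge0 h : (forall x, 0 <= h x) -> (0 <= \int[mu]_x (h x)%:E)%E.
  by move=> h0; apply: integral_ge0 => x _; rewrite lee_fin.
rewrite ge0_integralD//; last 4 first.
- by move=> x _; rewrite lee_fin.
- exact/measurable_EFinP.
- by move=> x _; rewrite lee_fin.
- exact/measurable_EFinP.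
move=> le_a.
have [|A _ AE] := @ge0_integral_real _ h10 a.
  by apply: le_trans le_a; rewrite leeDl// ge0.
have [|B _ BE] := @ge0_integral_real _ h20 a.
  by apply: le_trans le_a; rewrite leeDr// ge0.
by exists A, B; split => //; move: le_a; rewrite AE BE -EFinD lee_fin.
Qed.

Lemma integral_gt0_support h1 h2 :
  measurable_fun setT h1 -> measurable_fun setT h2 ->
  (forall x, 0 <= h1 x) -> (forall x, 0 <= h2 x) ->
  (forall x, h1 x = 0 -> h2 x = 0) ->
  (0 < \int[mu]_x (h2 x)%:E)%E -> (0 < \int[mu]_x (h1 x)%:E)%E.
Proof.
move=> mh1 mh2 h10 h20 h12 I2.
rewrite lt_neqAle integral_ge0 ?andbT; last by move=> x _; rewrite lee_fin.
apply/negP => /eqP I1; move: I2; rewrite (_ : integral _ _ _ = 0%E) ?ltxx//.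
have Z k : (forall x, 0 <= k x) ->
    (\int[mu]_x `|(k x)%:E| = \int[mu]_x (k x)%:E)%E.
  by move=> k0; apply: eq_integral => x _; rewrite gee0_abs// lee_fin.
rewrite -Z//; apply/ae_eq_integral_abs => //; first exact/measurable_EFinP.
have /ae_eq_integral_abs : (\int[mu]_x `|(h1 x)%:E| = 0)%E by rewrite Z.
move=> /(_ measurableT) []; first exact/measurable_EFinP.
move=> N [mN N0 sN]; exists N; split => // x /= nh; apply: sN => /= h1x.
by apply: nh => _; congr EFin; apply: h12; case: (h1x I).
Qed.

(** The function [s^(1 - t) / (1 - t)] is concave for every [t > 0] other than 1,
    and its tangent inequality between [a] and [b] is integrated against [w].
    The two signs of [1 - t] are treated separately so that all integrands stay
    nonnegative. *)
Lemma concave_power_integral_ge (w a b : T -> R) (t I A kap : R) :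
  0 < t -> t != 1 ->
  measurable_fun setT w -> measurable_fun setT a -> measurable_fun setT b ->
  (forall x, 0 <= w x) -> (forall x, 0 < a x) -> (forall x, 0 < b x) ->
  (\int[mu]_x (w x * a x `^ (1 - t))%:E = I%:E)%E ->
  (\int[mu]_x (w x * b x `^ (1 - t))%:E = (kap * I)%:E)%E ->
  (\int[mu]_x (w x * (a x `^ (- t) * b x))%:E = A%:E)%E ->
  I * (1 + (kap - 1) / (1 - t)) <= A.
Proof.
move=> t0 t1 mw ma mb w0 a0 b0 Ia Ib Iab.
have mp (k : T -> R) s : measurable_fun setT k -> measurable_fun setT (fun x => k x `^ s).
  by move=> mk; exact: (measurableT_comp (measurable_powR s) mk).
have ma1 : measurable_fun setT (fun x => w x * a x `^ (1 - t)).
  by apply: measurable_funM => //; exact: mp.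
have mb1 : measurable_fun setT (fun x => w x * b x `^ (1 - t)).
  by apply: measurable_funM => //; exact: mp.
have mab : measurable_fun setT (fun x => w x * (a x `^ (- t) * b x)).
  by apply: measurable_funM => //; apply: measurable_funM => //; exact: mp.
have p0 (c s : R) x : 0 <= w x * c `^ s by rewrite mulr_ge0// powR_ge0.
have p1 x : 0 <= w x * (a x `^ (- t) * b x).
  by rewrite !mulr_ge0 ?powR_ge0// ltW.
have ratio x : b x `^ (1 - t) = a x `^ (1 - t) * (b x / a x) `^ (1 - t).
  rewrite -powRM; last 2 first.
  - exact: ltW.
  - by rewrite divr_ge0 ?ltW.
  by rewrite mulrCA divff ?mulr1// gt_eqF.
have abE x : a x `^ (- t) * b x = a x `^ (1 - t) * (b x / a x).
  rewrite powRD; last by apply/implyP => _; rewrite gt_eqF.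
  rewrite powRr1; last exact: ltW.
  by field; rewrite gt_eqF.
have s0 x : 0 < b x / a x by rewrite divr_gt0.
have [t1'|t1'] := ltP t 1.
  have : kap * I <= t * I + (1 - t) * A.
    rewrite -lee_fin -Ib.
    apply: (ge0_integral_le_combination (h1 := fun x => w x * a x `^ (1 - t))
      (h2 := fun x => w x * (a x `^ (- t) * b x))) => //.
    - exact: ltW.
    - by lra.
    - move=> x; rewrite ratio abE.
      have := @powR_bernoulli_le R (b x / a x) (1 - t) (ltW (s0 x)).
      rewrite subr_gt0 t1' => /(_ erefl).
      have t1'' : 1 - t <= 1 by lra.
      move=> /(_ t1'') h.
      have : w x * a x `^ (1 - t) * (b x / a x) `^ (1 - t) <=
        w x * a x `^ (1 - t) * (1 + (1 - t) * (b x / a x - 1)) by rewrite ler_wpM2l.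
      lra.
    - by rewrite Ia.
    - by rewrite Iab.
  move=> h; have u0 : 0 < 1 - t by lra.
  rewrite -(ler_pM2l u0) (_ : (1 - t) * _ = I * (1 - t + kap - 1)); first lra.
  by field; rewrite gt_eqF.
have t1'' : 1 < t by rewrite lt_neqAle eq_sym t1.
have : t * I <= 1 * (kap * I) + (t - 1) * A.
  rewrite -lee_fin.
  have -> : ((t * I)%:E = \int[mu]_x (t * (w x * a x `^ (1 - t)))%:E)%E.
    rewrite EFinM -Ia -ge0_integralZl_EFin//; last 3 first.
    - by move=> x _; rewrite lee_fin.
    - exact/measurable_EFinP.
    - exact: ltW.
  apply: (ge0_integral_le_combination (h1 := fun x => w x * b x `^ (1 - t))
      (h2 := fun x => w x * (a x `^ (- t) * b x))) => //.
  - exact: measurable_funM.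
  - by move=> x; rewrite mulr_ge0// ltW.
  - by lra.
  - move=> x; rewrite ratio abE.
    have := @powR_bernoulli_neg R (b x / a x) (1 - t) (s0 x).
    have t2 : 1 - t <= 0 by lra.
    move=> /(_ t2) h.
    have : w x * a x `^ (1 - t) * (1 + (1 - t) * (b x / a x - 1)) <=
      w x * a x `^ (1 - t) * (b x / a x) `^ (1 - t) by rewrite ler_wpM2l.
    lra.
  - by rewrite Ib.
  - by rewrite Iab.
move=> h; have u0 : 0 < t - 1 by lra.
rewrite -(ler_pM2l u0) (_ : (t - 1) * _ = I * (t - kap)); first lra.
by field; rewrite subr_eq0 eq_sym.
Qed.

End ge0_real_integrals.

(** * Potentials coupled by a power of the distance *)

Section integral_system.
Variables (R : realType) (m : nat) (q theta : R).
Hypotheses (m_gt0 : (0 < m)%N) (q_gt0 : 0 < q) (theta_gt0 : 0 < theta).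
Variables (u : 'rV[R]_m -> R) (V g : 'rV[R]_m.+1 -> R).
Hypotheses (measurable_u : measurable_fun setT u)
  (mg : measurable_fun setT g).
Hypotheses (u_gt0 : forall y, 0 < u y) (V_gt0 : forall x, 0 < V x)
  (g_ge0 : forall x, 0 <= g x)
  (g_gt0 : forall x, (0 < g x) = (0 < lastc x)).

Local Notation mu := (lebesgue_rV R m).
Local Notation nu := (lebesgue_rV R m.+1).
Local Notation f y := (u y `^ (- theta)).
Local Notation K x y := (nsq ((x : 'rV[R]_m.+1) - snoc (y : 'rV[R]_m) 0)).

Hypothesis uE : forall y,
  (\int[nu]_x (K x y `^ q * g x)%:E = (u y)%:E)%E.
Hypothesis VE : forall x, 0 < lastc x ->
  (\int[mu]_y (K x y `^ q * f y)%:E = (V x)%:E)%E.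

Let g_eq0 x : lastc x <= 0 -> g x = 0.
Proof. by move=> x0; apply/eqP; rewrite eq_le g_ge0 andbT leNgt g_gt0 -leNgt. Qed.

Let f_gt0 y : 0 < f y. Proof. exact: powR_gt0. Qed.
Let f_ge0 y : 0 <= f y. Proof. exact: powR_ge0. Qed.

Let mpow d (T : measurableType d) (h : T -> R) (s : R) :
  measurable_fun setT h -> measurable_fun setT (fun x => h x `^ s).
Proof. by move=> mh; exact: (measurableT_comp (measurable_powR s) mh). Qed.

Let mf : measurable_fun setT (fun y => f y). Proof. exact: mpow. Qed.

Let T := ('rV[R]_m * 'rV[R]_m.+1)%type.

Let msnoc0 : measurable_fun setT (fun z : T => snoc z.1 0).
Proof.
apply: measurable_fun_rV => i.
rewrite [X in measurable_fun _ X](_ : _ = fun z : T =>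
   if unlift ord_max i is Some j then z.1 ord0 j else 0); last first.
  by apply/funext => y; rewrite !mxE.
by case: unlift => [j|//]; exact: (measurableT_comp (measurable_coord j) measurable_fst).
Qed.

Let mdil_u (l : R) :
  measurable_fun setT (fun z : T => nsq (z.2 - l *: snoc z.1 0)).
Proof.
apply: measurable_nsqB; first exact: measurable_snd.
exact: (measurableT_comp (measurable_scale_rV l) msnoc0).
Qed.

Let mdil_V (l : R) :
  measurable_fun setT (fun z : T => nsq (l *: z.2 - snoc z.1 0)).
Proof.
apply: measurable_nsqB; last exact: msnoc0.
exact: (measurableT_comp (measurable_scale_rV l) measurable_snd).
Qed.

Let mK : measurable_fun setT (fun z : T => K z.2 z.1).
Proof. by apply: measurable_nsqB; [exact: measurable_snd|exact: msnoc0]. Qed.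

Let mKx x : measurable_fun setT (fun y : 'rV[R]_m => K x y).
Proof. exact: (measurableT_comp mK (pair2_measurable x)). Qed.

Let mKy y : measurable_fun setT (fun x : 'rV[R]_m.+1 => K x y).
Proof. exact: (measurableT_comp mK (pair1_measurable y)). Qed.

Let mnsq n : measurable_fun setT (@nsq R n).
Proof. by apply: measurable_nsq => i; exact: measurable_coord. Qed.

Let mu_ge0 y : 0 <= u y. Proof. exact: ltW. Qed.

Let K_gt0 x y : 0 < lastc x -> 0 < K x y.
Proof.
move=> x0; rewrite nsqB_snoc0; apply: ltr_wpDl; first exact: nsq_ge0.
by rewrite exprn_gt0.
Qed.

Let nsq_snoc_le y x : nsq y <= 2 * (K x y + nsq x).
Proof.
rewrite -nsq_snoc0; apply: le_trans (nsq_quasi_triangle (snoc y 0) x) _.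
by rewrite -(nsqN (snoc y 0 - x)) opprB.
Qed.

Let K0 x : K x 0 = nsq x.
Proof.
congr nsq; rewrite (_ : snoc 0 0 = 0) ?subr0//.
by apply/rowP => i; rewrite !mxE; case: unlift => // j; rewrite mxE.
Qed.

Let mKg y s : measurable_fun setT (fun x : 'rV[R]_m.+1 => K x y `^ s * g x).
Proof. by apply: measurable_funM => //; exact: mpow. Qed.

Let mKf x s : measurable_fun setT (fun y : 'rV[R]_m => K x y `^ s * f y).
Proof. by apply: measurable_funM => //; exact: mpow. Qed.

Let Kg_ge0 y s x : 0 <= K x y `^ s * g x.
Proof. by rewrite mulr_ge0 ?powR_ge0. Qed.

Let Kf_ge0 y s x : 0 <= K x y `^ s * f y.
Proof. by rewrite mulr_ge0 ?powR_ge0. Qed.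

(** Both [u(0)] and [u(y1)] are finite, and every point of the half-space is at
    distance at least [|y1| / 2] from one of [0] and [y1]; so [g] itself is
    integrable. *)
Lemma density_mass_finite : exists2 M, 0 < M & (\int[nu]_x (g x)%:E = M%:E)%E.
Proof.
(* any nonzero boundary point would do *)
pose y1 : 'rV[R]_m := const_mx 1.
have y1_ge1 : 1 <= nsq y1.
  by have := coord_le_nsq y1 (Ordinal m_gt0); rewrite mxE expr1n.
have [|M M0 ME] := @ge0_integral_real _ _ _ nu g g_ge0
   (2 `^ q * 2 `^ q * u y1 + 2 `^ q * 2 `^ q * u 0).
  apply: (ge0_integral_le_combination (h1 := fun x => K x y1 `^ q * g x)
    (h2 := fun x => K x 0 `^ q * g x)); rewrite ?uE ?mulr_ge0 ?powR_ge0// => x.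
  rewrite -[leLHS]mul1r; apply: ler_combination => //.
  apply: (@le_trans _ _ ((2 * (K x y1 + nsq x)) `^ q)).
    by apply: powR_ge1; rewrite ?(ltW q_gt0)// (le_trans y1_ge1).
  rewrite powRM ?addr_ge0 ?nsq_ge0// K0 -!mulrA -mulrDr ler_wpM2l ?powR_ge0//.
  by apply: powR_add_le; rewrite ?nsq_ge0 ?(ltW q_gt0).
exists M => //; rewrite -lte_fin -ME.
apply: (@integral_gt0_support _ _ _ _ g (fun x => K x 0 `^ q * g x)) => //.
  by move=> x ->; rewrite mulr0.
by rewrite uE lte_fin.
Qed.

(** The kernel dominates [x_n^(2 q)], whose integral against [g] is a positive
    lower bound of [u]; the quasi-triangle inequality between [y], [x] and [0]
    gives the growth in [|y|]. *)
Lemma potential_lower_bound : exists2 c, 0 < c &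
  forall y : 'rV[R]_m, c * (1 + nsq y `^ q) <= u y.
Proof.
have [M M0 ME] := density_mass_finite.
have mlast : measurable_fun setT (fun x : 'rV[R]_m.+1 => lastc x).
  exact: measurable_coord.
pose h x : R := g x * (lastc x ^+ 2) `^ q.
have mh : measurable_fun setT h.
  by apply: measurable_funM => //; apply: mpow; exact: measurable_funX.
have h0 x : 0 <= h x by rewrite mulr_ge0 ?powR_ge0.
have hK x y : h x <= 1 * (K x y `^ q * g x).
  rewrite /h mul1r mulrC ler_wpM2r//.
  apply: ge0_ler_powR; rewrite ?nnegrE ?(ltW q_gt0) ?sqr_ge0 ?nsq_ge0//.
  by rewrite nsqB_snoc0 lerDr nsq_ge0.
have hu y : (\int[nu]_x (h x)%:E <= (1 * u y)%:E)%E.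
  by apply: (ge0_integral_le_multiple (h1 := fun x => K x y `^ q * g x)); rewrite ?uE.
have [c _ cE] := ge0_integral_real h0 (hu 0).
have c0 : 0 < c.
  rewrite -lte_fin -cE.
  apply: (@integral_gt0_support _ _ _ _ h (fun x => K x 0 `^ q * g x)) => //; last first.
    by rewrite uE lte_fin.
  move=> x /eqP; rewrite mulf_eq0 => /orP[/eqP->|]; first by rewrite mulr0.
  rewrite powR_eq0 sqrf_eq0 => /andP[/eqP x0 _].
  by rewrite g_eq0 ?mulr0// x0.
have cu y : c <= u y by have := hu y; rewrite cE lee_fin mul1r.
have Mu y : M * nsq y `^ q <= 2 `^ q * 2 `^ q * u y + 2 `^ q * 2 `^ q * u 0.
  rewrite -lee_fin.
  have -> : ((M * nsq y `^ q)%:E = \int[nu]_x (nsq y `^ q * g x)%:E)%E.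
    rewrite mulrC EFinM -ME -ge0_integralZl_EFin//; last 3 first.
    - by move=> x _; rewrite lee_fin.
    - exact/measurable_EFinP.
    - exact: powR_ge0.
  apply: (ge0_integral_le_combination (h1 := fun x => K x y `^ q * g x)
    (h2 := fun x => K x 0 `^ q * g x)); rewrite ?uE ?mulr_ge0 ?powR_ge0//.
  - exact: measurable_funM.
  - by move=> x; rewrite mulr_ge0// powR_ge0.
  - move=> x; apply: ler_combination => //.
    apply: (@le_trans _ _ ((2 * (K x y + nsq x)) `^ q)).
      apply: ge0_ler_powR; rewrite ?nnegrE ?(ltW q_gt0) ?nsq_ge0//.
      by rewrite mulr_ge0// addr_ge0// nsq_ge0.
    rewrite powRM ?addr_ge0 ?nsq_ge0// K0 -!mulrA -mulrDr ler_wpM2l ?powR_ge0//.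
    by apply: powR_add_le; rewrite ?nsq_ge0 ?(ltW q_gt0).
pose B := 2 `^ q * 2 `^ q : R.
have B0 : 0 < B by rewrite mulr_gt0 ?powR_gt0.
pose D := B / M * (1 + u 0 / c) + c^-1.
have D0 : 0 < D.
  by rewrite addr_gt0 ?invr_gt0// mulr_gt0 ?divr_gt0// addr_gt0// divr_gt0.
exists D^-1; first by rewrite invr_gt0.
move=> y; rewrite ler_pdivrMl//.
have h1 : 1 <= c^-1 * u y by rewrite ler_pdivlMl// mulr1.
have h2 : nsq y `^ q <= B / M * (1 + u 0 / c) * u y.
  apply: (@le_trans _ _ (B / M * (u y + u 0))).
    by rewrite mulrAC ler_pdivlMr// mulrC (mulrDr B); exact: Mu.
  rewrite -(mulrA (B / M)) ler_wpM2l ?divr_ge0 ?(ltW B0) ?(ltW M0)//.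
  by rewrite mulrDl mul1r lerD2l -mulrA ler_peMr.
by rewrite /D mulrDl addrC lerD.
Qed.

Lemma potential_upper_bound : exists2 C, 0 < C &
  forall y : 'rV[R]_m, u y <= C * (1 + nsq y `^ q).
Proof.
have [M M0 ME] := density_mass_finite.
pose B := 2 `^ q * 2 `^ q : R.
have B0 : 0 < B by rewrite mulr_gt0 ?powR_gt0.
exists (B * (u 0 + M)); first by rewrite mulr_gt0// addr_gt0.
move=> y; apply: (@le_trans _ _ (B * u 0 + B * nsq y `^ q * M)); last first.
  have nq : 0 <= nsq y `^ q by exact: powR_ge0.
  rewrite -(mulrA B) -(mulrDr B) -(mulrA B) ler_pM2l// mulrDr mulr1; apply: lerD.
    by rewrite lerDl ltW.
  by rewrite mulrC ler_wpM2r// lerDr.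
rewrite -lee_fin -uE.
apply: (ge0_integral_le_combination (h1 := fun x => K x 0 `^ q * g x) (h2 := g));
  rewrite ?uE ?ME ?mulr_ge0 ?powR_ge0// => x.
rewrite mulrA -mulrDl ler_wpM2r// K0.
apply: (@le_trans _ _ ((2 * (nsq x + nsq y)) `^ q)).
  apply: ge0_ler_powR; rewrite ?nnegrE ?(ltW q_gt0) ?nsq_ge0//.
    by rewrite mulr_ge0// addr_ge0// nsq_ge0.
  by rewrite -(nsq_snoc0 y) nsqB_le.
rewrite powRM ?addr_ge0 ?nsq_ge0// /B -!mulrA -mulrDr ler_wpM2l ?powR_ge0//.
by apply: powR_add_le; rewrite ?nsq_ge0 ?(ltW q_gt0).
Qed.

(** Since [u] is comparable with [1 + |y|^(2 q)], it changes by a bounded factor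
    when [|y|] does. *)
Lemma negative_power_doubling (B : R) : 1 <= B -> exists2 C, 0 < C &
  forall y z : 'rV[R]_m, nsq z <= B * nsq y -> f y <= C * f z.
Proof.
move=> B1.
have B0 : 0 <= B by exact: le_trans B1.
have [c c0 cu] := potential_lower_bound; have [C C0 uC] := potential_upper_bound.
have Bq : 1 <= B `^ q.
  by apply: powR_ge1; rewrite ?(ltW q_gt0).
have Bq0 : 0 < B `^ q by exact: lt_le_trans Bq.
pose D := C * B `^ q / c.
have D0 : 0 < D by rewrite divr_gt0// mulr_gt0.
exists (D `^ theta); first exact: powR_gt0.
move=> y z zy.
have zu : u z <= D * u y.
  apply: le_trans (uC z) _; rewrite /D -!mulrA ler_pM2l//.
  apply: (@le_trans _ _ (B `^ q * (1 + nsq y `^ q))); last first.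
    by rewrite ler_pM2l// ler_pdivlMl.
  rewrite mulrDr mulr1; apply: lerD => //.
  rewrite -powRM ?nsq_ge0//.
  by apply: ge0_ler_powR; rewrite ?nnegrE ?nsq_ge0 ?(ltW q_gt0)// mulr_ge0 ?nsq_ge0.
rewrite !powRN -ler_pdivrMl ?powR_gt0// -invfM lef_pV2 ?posrE ?mulr_gt0 ?powR_gt0//.
rewrite -powRM ?(ltW D0)//; apply: ge0_ler_powR; rewrite ?nnegrE ?(ltW theta_gt0)//.
by rewrite mulr_ge0// ltW.
Qed.

Let e1 : 'rV[R]_m.+1 := snoc 0 1.

Let e1_last : lastc e1 = 1. Proof. by rewrite /lastc snoc_max. Qed.

(** The finiteness of the potential [V] at the single point [e1] of height one
    controls both integrals, the distance from [e1] to the boundary being at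
    least 1 and comparable with [1 + |y|]. *)
Lemma negative_power_moments : exists2 F, 0 < F &
  (\int[mu]_y (f y * nsq y `^ q)%:E <= F%:E)%E /\ (\int[mu]_y (f y)%:E <= F%:E)%E.
Proof.
have e1_gt0 : 0 < lastc e1 by rewrite e1_last.
have K1 y : 1 <= K e1 y by rewrite nsqB_snoc0 e1_last expr1n lerDr nsq_ge0.
have nsq1 : nsq e1 = 1.
  rewrite nsq_split e1_last expr1n (_ : nsq _ = 0) ?add0r//.
  by rewrite /nsq big1// => i _; rewrite mxE snoc_lift mxE expr0n.
have pow41 : 1 <= 4 `^ q :> R.
  by apply: powR_ge1; rewrite ?(ltW q_gt0) ?ler1n.
have dom (h : 'rV[R]_m -> R) : measurable_fun setT h -> (forall y, 0 <= h y) ->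
    (forall y, h y <= 4 `^ q * (K e1 y `^ q * f y)) ->
    (\int[mu]_y (h y)%:E <= (4 `^ q * V e1)%:E)%E.
  move=> mh h0 hle.
  by apply: (ge0_integral_le_multiple (h1 := fun y => K e1 y `^ q * f y));
    rewrite ?VE ?powR_ge0.
exists (4 `^ q * V e1); first by rewrite mulr_gt0 ?powR_gt0.
split; apply: dom => //.
- by apply: measurable_funM; [exact: mf|apply: mpow; exact: mnsq].
- by move=> y; rewrite mulr_ge0 ?powR_ge0.
- move=> y; rewrite mulrC mulrA ler_wpM2r// -powRM ?nsq_ge0//.
  apply: ge0_ler_powR; rewrite ?nnegrE ?nsq_ge0 ?(ltW q_gt0)//.
    by rewrite mulr_ge0 ?nsq_ge0.
  have := nsq_snoc_le y e1; rewrite nsq1; have := K1 y; lra.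
- move=> y; rewrite mulrA ler_peMl//.
  rewrite -[leLHS]mulr1; apply: ler_pM => //.
  by apply: powR_ge1; rewrite ?(ltW q_gt0).
Qed.

Let sqrt_pow (a : R) : 0 <= a -> Num.sqrt a ^+ m = a `^ (m%:R / 2).
Proof.
move=> a0; rewrite -powR12_sqrt// -powR_mulrn ?powR_ge0//.
by rewrite -powRrM mulrC.
Qed.

(** Average [f |z|^(2 q)] over the cube of the points [z] whose coordinates lie
    between [|y|] and [2 |y|]: its volume is [|y|^m], and [f] is there
    comparable with [f(y)] by doubling. *)
Lemma negative_power_decay : exists2 C, 0 < C & forall y : 'rV[R]_m,
  f y * nsq y `^ q * nsq y `^ (m%:R / 2) <= C.
Proof.
have B1 : 1 <= 4 * m%:R :> R by rewrite -natrM ler1n muln_gt0.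
have [C C0 dbl] := negative_power_doubling B1.
have [F F0 [Fmom _]] := negative_power_moments.
exists (C * F); first by rewrite mulr_gt0.
move=> y; rewrite -sqrt_pow ?nsq_ge0//; set r := Num.sqrt (nsq y).
have r0 : 0 <= r by exact: sqrtr_ge0.
have rE : r ^+ 2 = nsq y by rewrite sqr_sqrtr// nsq_ge0.
pose Q := [set z : 'rV[R]_m | forall i, `[r, r + r]%classic (z ord0 i)].
have mQ : measurable Q.
  by apply: (@measurable_rV_box R m (fun i => _)) => i; exact: measurable_itv.
have QE : mu Q = (r ^+ m)%:E by exact: (@lebesgue_measure_cube R m (fun=> r) r r0).
rewrite -lee_fin.
have -> : ((f y * nsq y `^ q * r ^+ m)%:E =
    \int[mu]_z (f y * nsq y `^ q * \1_Q z)%:E)%E.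
  under eq_integral do rewrite EFinM.
  rewrite ge0_integralZl_EFin ?mulr_ge0 ?powR_ge0//; last exact/measurable_EFinP.
  by rewrite integral_indic// setIT EFinM; congr (_ * _)%E.
apply: (ge0_integral_le_multiple (h1 := fun z => f z * nsq z `^ q)) => //.
- exact: measurable_funM.
- by apply: measurable_funM; [exact: mf|apply: mpow; exact: mnsq].
- by move=> z; rewrite !mulr_ge0 ?powR_ge0.
- by move=> z; rewrite mulr_ge0 ?powR_ge0.
- exact: ltW.
move=> z; rewrite indicE; have [zQ|_] := boolP (z \in Q); last first.
  by rewrite mulr0 !mulr_ge0 ?powR_ge0// ltW.
rewrite mulr1; move: zQ; rewrite inE /Q /= => zQ.
have low : nsq y <= nsq z.
  apply: le_trans (coord_le_nsq z (Ordinal m_gt0)).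
  have := zQ (Ordinal m_gt0); rewrite in_itv/= => /andP[zr _].
  by rewrite -rE ler_sqr ?nnegrE// (le_trans r0 zr).
have up : nsq z <= 4 * m%:R * nsq y.
  apply: (@le_trans _ _ (\sum_(i < m) 4 * nsq y)); last first.
    by rewrite sumr_const card_ord -mulrnAl mulr_natr.
  apply: ler_sum => i _; have := zQ i; rewrite in_itv/= => /andP[z1 z2].
  have -> : 4 * nsq y = (r + r) ^+ 2 by rewrite -rE; ring.
  by rewrite ler_sqr ?nnegrE ?addr_ge0// (le_trans r0 z1).
rewrite mulrA; apply: ler_pM; rewrite ?powR_ge0//; first exact: dbl.
by apply: ge0_ler_powR; rewrite ?nnegrE ?nsq_ge0 ?(ltW q_gt0).
Qed.

Let fgE (z : T) : 0 <= f z.1 * g z.2.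
Proof. by rewrite mulr_ge0 ?powR_ge0. Qed.

Let mfg : measurable_fun setT
  (fun z : T => f z.1 * g z.2).
Proof.
apply: measurable_funM; first exact: (measurableT_comp mf measurable_fst).
exact: (measurableT_comp mg measurable_snd).
Qed.

Let energy_ge0 (h : T -> R) s z :
  (0 <= (f z.1 * g z.2 * h z `^ s)%:E)%E.
Proof. by rewrite lee_fin mulr_ge0// powR_ge0. Qed.

Let menergy (h : T -> R) r : measurable_fun setT h ->
  measurable_fun setT (fun z : T => f z.1 * g z.2 * h z `^ r).
Proof. by move=> mh; apply: measurable_funM; [exact: mfg|exact: mpow]. Qed.

Lemma energy_dilate_u (l : R) :
  (\int[mu \x nu]_z (f z.1 * g z.2 * nsq (z.2 - l *: snoc z.1 0) `^ q)%:E =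
   \int[mu]_y (f y * u (l *: y)%R)%:E)%E.
Proof.
rewrite fubini_tonelli1; last 2 first.
- by apply/measurable_EFinP; exact: menergy.
- exact: energy_ge0.
apply: eq_integral => y _; rewrite /fubini_F /=.
rewrite EFinM -uE scale_snoc0 -ge0_integralZl_EFin//; last 2 first.
- by move=> x _; rewrite lee_fin mulr_ge0// powR_ge0.
- by apply/measurable_EFinP; rewrite -scale_snoc0; exact: mKg.
by apply: eq_integral => x _; rewrite -EFinM; congr EFin; ring.
Qed.

Lemma energy_dilate_V (l : R) : 0 < l ->
  (\int[mu \x nu]_z (f z.1 * g z.2 * nsq (l *: z.2 - snoc z.1 0) `^ q)%:E =
   \int[nu]_x (g x * V (l *: x)%R)%:E)%E.
Proof.
move=> l0.
rewrite fubini_tonelli2; last 2 first.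
- by apply/measurable_EFinP; exact: menergy.
- exact: energy_ge0.
apply: eq_integral => x _; rewrite /fubini_G /=.
have [x0|x0] := ltP 0 (lastc x); last first.
  rewrite g_eq0// mul0r; under eq_integral do rewrite mulr0 mul0r.
  by rewrite integral0.
rewrite EFinM -VE; last by rewrite /lastc mxE mulr_gt0.
rewrite -ge0_integralZl_EFin//; last 2 first.
- by move=> y _; rewrite lee_fin mulr_ge0// powR_ge0.
- by apply/measurable_EFinP; exact: mKf.
by apply: eq_integral => y _; rewrite -EFinM; congr EFin; ring.
Qed.

Lemma energy_u : (\int[mu \x nu]_z (f z.1 * g z.2 * K z.2 z.1 `^ q)%:E =
  \int[mu]_y (f y * u y)%:E)%E.
Proof.
transitivity (\int[mu \x nu]_z
    (f z.1 * g z.2 * nsq (z.2 - 1 *: snoc z.1 0) `^ q)%:E)%E.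
  apply: eq_integral => z _.
  by congr (_ * nsq (_ - _) `^ _)%:E; exact/esym/scale1r.
rewrite energy_dilate_u; apply: eq_integral => y _.
by congr (_ * u _)%:E; exact: scale1r.
Qed.

Lemma energy_V : (\int[mu \x nu]_z (f z.1 * g z.2 * K z.2 z.1 `^ q)%:E =
  \int[nu]_x (g x * V x)%:E)%E.
Proof.
transitivity (\int[mu \x nu]_z
    (f z.1 * g z.2 * nsq (1 *: z.2 - snoc z.1 0) `^ q)%:E)%E.
  apply: eq_integral => z _.
  by congr (_ * nsq (_ - _) `^ _)%:E; exact/esym/scale1r.
rewrite energy_dilate_V//; apply: eq_integral => x _.
by congr (_ * V _)%:E; exact: scale1r.
Qed.

Lemma energy_finite : exists2 I, 0 < I &
  (\int[mu \x nu]_z (f z.1 * g z.2 * K z.2 z.1 `^ q)%:E = I%:E)%E.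
Proof.
have [C C0 uC] := potential_upper_bound.
have [F F0 [Fmom Fmass]] := negative_power_moments.
have mfu : measurable_fun setT (fun y => f y * u y) by exact: measurable_funM.
have fu0 y : 0 <= f y * u y by rewrite mulr_ge0.
have [|I I0 IE] := @ge0_integral_real _ _ _ mu _ fu0 (C * F + C * F).
  apply: (ge0_integral_le_combination (h1 := fun y => f y)
      (h2 := fun y => f y * nsq y `^ q)) => //; try exact: ltW.
  - by apply: measurable_funM; [exact: mf|apply: mpow; exact: mnsq].
  - by move=> y; rewrite mulr_ge0 ?powR_ge0.
  - move=> y; rewrite -mulrDr -[X in X + _ * _]mulr1 -mulrDr mulrCA ler_wpM2l//.
exists I; last by rewrite energy_u.
rewrite -lte_fin -IE.
apply: (@integral_gt0_support _ _ _ _ _ (fun y => K e1 y `^ q * f y)) => //.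
- by move=> y /eqP; rewrite mulf_eq0 !gt_eqF.
- by rewrite VE ?lte_fin// e1_last.
Qed.

(** Far from the diagonal, where [|y| < 2 |x - y|], the weight is comparable with
    the kernel and the integral with the energy.  Near the diagonal [|x|] and
    [|y|] are comparable; the decay of [f] replaces [f(y) S^(q + s)] by
    a multiple of [|x|^(2 s - m)], and the integral of [|x - y|^(-2 s)] over the
    boundary points at distance at most [|x|] is a multiple of [|x|^(m - 2 s)].
    The two powers cancel, and what is left is the mass of [g]. *)
Lemma weighted_energy_finite (s : R) : 0 <= s -> s < 2^-1 -> exists2 W, 0 <= W &
  (\int[mu \x nu]_z (f z.1 * g z.2 *
     (K z.2 z.1 `^ (- s) * (nsq z.2 + nsq z.1) `^ (q + s)))%:E <= W%:E)%E.
Proof.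
move=> s0 s1.
have [I I0 IE] := energy_finite; have [M M0 ME] := density_mass_finite.
have [D D0 decay] := negative_power_decay.
have [Cs Cs0 sing] := singular_integral_le m_gt0 s0 s1.
pose e := s - m%:R / 2.
have m1 : 1 <= m%:R :> R by rewrite ler1n.
have e0 : e <= 0 by rewrite /e; lra.
pose far (z : T) := f z.1 * g z.2 * K z.2 z.1 `^ q.
pose near (z : T) := (g z.2 * nsq z.2 `^ e) *
  (if K z.2 z.1 <= nsq z.2 then K z.2 z.1 `^ (- s) else 0).
have ge0_if (z : T) :
    0 <= (if K z.2 z.1 <= nsq z.2 then K z.2 z.1 `^ (- s) else 0).
  by case: ifP => // _; exact: powR_ge0.
have near_ge0 z : 0 <= near z by rewrite mulr_ge0// mulr_ge0 ?powR_ge0.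
have mnsq2 : measurable_fun setT (fun z : T => nsq z.2).
  exact: (measurableT_comp (@mnsq _) measurable_snd).
have mnsq1 : measurable_fun setT (fun z : T => nsq z.1).
  exact: (measurableT_comp (@mnsq _) measurable_fst).
have mnear : measurable_fun setT near.
  apply: measurable_funM.
    apply: measurable_funM; last by apply: mpow.
    exact: (measurableT_comp mg measurable_snd).
  apply: measurable_fun_ifT => //; last by apply: mpow.
  by apply: measurable_fun_ler.
have near_int : (\int[mu \x nu]_z (near z)%:E <= (Cs * M)%:E)%E.
  rewrite fubini_tonelli2; last 2 first.
  - exact/measurable_EFinP.
  - by move=> z; rewrite lee_fin.
  have mG := measurable_fun_fubini_tonelli_G (m1 := mu) (fun z => (near z)%:E)
    (proj2 (measurable_EFinP _ _) mnear) (fun z => near_ge0 z).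
  apply: (@le_trans _ _ (\int[nu]_x (Cs * g x)%:E)%E).
    apply: ge0_le_integral => //.
    - by move=> x _; apply: integral_ge0 => y _; rewrite lee_fin.
    - by apply/measurable_EFinP; exact: measurable_funM.
    move=> x _; rewrite /fubini_G /near /=.
    under eq_integral do rewrite EFinM.
    have [x0|x0] := ltP 0 (lastc x); last first.
      under eq_integral do rewrite g_eq0// mul0r mul0e.
      by rewrite integral0 g_eq0// mulr0.
    have nx0 : 0 < nsq x by rewrite -K0 K_gt0.
    rewrite ge0_integralZl_EFin ?mulr_ge0 ?powR_ge0//; last 2 first.
    - by move=> y _; rewrite lee_fin; exact: (ge0_if (y, x)).
    - apply/measurable_EFinP; apply: measurable_fun_ifT => //; last exact: mpow.
      by apply: measurable_fun_ler.
    pose c : 'rV[R]_m := \row_i x ord0 (lift ord_max i).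
    have r0 : 0 < Num.sqrt (nsq x) by rewrite sqrtr_gt0.
    have := sing c (fun y => K x y) _ r0 (@mKx x) (fun y => @K_gt0 x y x0).
    rewrite sqr_sqrtr ?nsq_ge0// sqrt_pow ?nsq_ge0//.
    have cK y : nsq (y - c) <= K x y by rewrite nsqB_snoc0 lerDl sqr_ge0.
    move=> /(_ cK) h.
    apply: (@le_trans _ _ ((g x * nsq x `^ e)%:E *
       (Cs * (nsq x `^ (m%:R / 2) * nsq x `^ (- s)))%:E)%E).
      by rewrite lee_wpmul2l// lee_fin mulr_ge0 ?powR_ge0.
    rewrite -EFinM lee_fin.
    have -> : nsq x `^ (m%:R / 2) * nsq x `^ (- s) = nsq x `^ (- e).
      rewrite -powRD; last by apply/implyP => _; rewrite gt_eqF.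
      by congr (_ `^ _); rewrite /e opprB.
    have : 0 < nsq x `^ e by exact: powR_gt0.
    rewrite powRN; move: (nsq x `^ e) => E E0.
    by rewrite (_ : g x * E * _ = Cs * g x)//; field; rewrite gt_eqF.
  under eq_integral do rewrite EFinM.
  rewrite ge0_integralZl_EFin// ?ME ?EFinM//.
  - by move=> x _; rewrite lee_fin.
  - exact/measurable_EFinP.
exists (14 `^ (q + s) * I + D * 4 `^ (q + s) * 4 `^ (- e) * (Cs * M)).
  by rewrite addr_ge0// ?mulr_ge0 ?powR_ge0// ltW.
apply: (ge0_integral_le_combination (h1 := far) (h2 := near)) => //.
- apply: measurable_funM; first exact: mfg.
  apply: measurable_funM; first exact: mpow.
  by apply: mpow; exact: measurable_funD.
- exact: menergy.
- by move=> z; rewrite mulr_ge0// mulr_ge0 ?powR_ge0.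
- by move=> z; rewrite mulr_ge0 ?powR_ge0.
- by rewrite !mulr_ge0 ?powR_ge0// ltW.
- move=> [y x]; rewrite /far /near /=.
  have [x0|x0] := ltP 0 (lastc x); last by rewrite g_eq0// !(mul0r, mulr0) addr0.
  have Kp := @K_gt0 x y x0; set k := K x y in Kp *.
  have nx0 : 0 < nsq x by rewrite -K0 K_gt0.
  (* the comparisons of [|x|], [|y|] and [|x - y|] all follow from these two *)
  have tr1 : nsq x <= 2 * (k + nsq y).
    by have := nsq_quasi_triangle x (snoc y 0); rewrite nsq_snoc0.
  have tr2 : nsq y <= 2 * (k + nsq x) := nsq_snoc_le y x.
  have ny0 := nsq_ge0 y.
  have qs0 : 0 <= q + s by rewrite addr_ge0// ltW.
  have [kfar|knear] := ltP (nsq y) (4 * k).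
    have Sk : (nsq x + nsq y) `^ (q + s) <= 14 `^ (q + s) * k `^ (q + s).
      rewrite -powRM ?(ltW Kp)//; apply: ge0_ler_powR => //.
      + by rewrite nnegrE addr_ge0// ltW.
      + by rewrite nnegrE mulr_ge0// ltW.
      + lra.
    have kk : k `^ (- s) * k `^ (q + s) = k `^ q.
      rewrite -powRD; last by apply/implyP => _; rewrite gt_eqF.
      by congr (_ `^ _); ring.
    apply: (@le_trans _ _ (14 `^ (q + s) * (f y * g x * k `^ q))).
      rewrite -kk [leRHS]mulrCA ler_wpM2l ?(fgE (y, x))//.
      by rewrite [leRHS]mulrCA ler_wpM2l ?powR_ge0.
    rewrite lerDl mulr_ge0 ?(near_ge0 (y, x))//.
    by rewrite !mulr_ge0 ?powR_ge0// ltW.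
  have ny : 0 < nsq y by lra.
  rewrite ifT; last by lra.
  rewrite ler_wpDl//; first by rewrite !mulr_ge0 ?powR_ge0.
  have Sy : (nsq x + nsq y) `^ (q + s) <= 4 `^ (q + s) * nsq y `^ (q + s).
    rewrite -powRM ?(ltW ny)//; apply: ge0_ler_powR => //.
    + by rewrite nnegrE addr_ge0// ltW.
    + by rewrite nnegrE mulr_ge0// ltW.
    + lra.
  have fy : f y * nsq y `^ (q + s) <= D * nsq y `^ e.
    have -> : nsq y `^ (q + s) = nsq y `^ q * nsq y `^ (m%:R / 2) * nsq y `^ e.
      rewrite -!powRD; try by apply/implyP => _; rewrite gt_eqF.
      by congr (_ `^ _); rewrite /e; ring.
    by rewrite !mulrA ler_wpM2r ?powR_ge0.
  have ye : nsq y `^ e <= 4 `^ (- e) * nsq x `^ e.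
    have -> : nsq x `^ e = 4 `^ e * (nsq x / 4) `^ e.
      rewrite -powRM//; last by rewrite divr_ge0// ltW.
      by congr (_ `^ _); field.
    rewrite mulrA -powRD; last by apply/implyP => _; rewrite pnatr_eq0.
    rewrite addNr powRr0 mul1r -[e]opprK !(powRN _ (- e)).
    rewrite lef_pV2 ?posrE ?powR_gt0 ?divr_gt0//.
    apply: ge0_ler_powR; rewrite ?nnegrE ?oppr_ge0 ?divr_ge0// ?ltW//.
    lra.
  have core : f y * (nsq x + nsq y) `^ (q + s) <=
      D * 4 `^ (q + s) * 4 `^ (- e) * nsq x `^ e.
    apply: (@le_trans _ _ (4 `^ (q + s) * (f y * nsq y `^ (q + s)))).
      by rewrite mulrCA ler_wpM2l.
    apply: (@le_trans _ _ (4 `^ (q + s) * (D * (4 `^ (- e) * nsq x `^ e)))).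
      rewrite ler_wpM2l ?powR_ge0//; apply: le_trans fy _.
      by rewrite ler_wpM2l// ltW.
    by rewrite le_eqVlt; apply/orP; left; apply/eqP; ring.
  rewrite (_ : f y * g x * _ =
    g x * k `^ (- s) * (f y * (nsq x + nsq y) `^ (q + s))); last ring.
  rewrite (_ : _ * (_ * _ * _) = g x * k `^ (- s) *
     (D * 4 `^ (q + s) * 4 `^ (- e) * nsq x `^ e)); last ring.
  by rewrite ler_wpM2l// mulr_ge0 ?powR_ge0.
- by rewrite IE.
Qed.

(** Integrate [powR_second_difference] against [f(y) g(x)]; the remainder is the
    weighted energy. *)
Lemma dilated_energy_second_difference : exists I C e : R,
  [/\ 0 < I, 0 <= C, 0 < e & [/\ (\int[mu]_y (f y * u y)%:E = I%:E)%E,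
    (\int[nu]_x (g x * V x)%:E = I%:E)%E &
    forall l, 2^-1 <= l -> l <= 3 / 2 -> exists A B : R,
    [/\ (\int[mu]_y (f y * u (l *: y)%R)%:E = A%:E)%E,
        (\int[nu]_x (g x * V (l *: x)%R)%:E = B%:E)%E &
        A + B <= 2 * l `^ q * I + C * `|1 - l| `^ (1 + e)]]].
Proof.
have [C [e [s [C0 e0 s0 s1 pointwise]]]] := powR_second_difference q_gt0.
have [I I0 IE] := energy_finite.
have [W W0 WE] := weighted_energy_finite s0 s1.
exists I, (C * W), e; split => //; first exact: mulr_ge0.
split.
- by rewrite -IE energy_u.
- by rewrite -IE energy_V.
move=> l l1 l2; have l0 : 0 < l by lra.
pose EX (z : T) := f z.1 * g z.2 * nsq (z.2 - l *: snoc z.1 0) `^ q.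
pose EY (z : T) := f z.1 * g z.2 * nsq (l *: z.2 - snoc z.1 0) `^ q.
have EX0 z : 0 <= EX z by rewrite mulr_ge0// powR_ge0.
have EY0 z : 0 <= EY z by rewrite mulr_ge0// powR_ge0.
have mEX : measurable_fun setT EX.
  exact: menergy.
have mEY : measurable_fun setT EY.
  exact: menergy.
pose bnd := 2 * l `^ q * I + C * `|1 - l| `^ (1 + e) * W.
have XY : (\int[mu \x nu]_z (EX z + EY z)%:E <= bnd%:E)%E.
  apply: (ge0_integral_le_combination
    (h1 := fun z : T => f z.1 * g z.2 * K z.2 z.1 `^ q)
    (h2 := fun z : T => f z.1 * g z.2 *
      (K z.2 z.1 `^ (- s) * (nsq z.2 + nsq z.1) `^ (q + s)))).
  - exact: (measurable_funD mEX mEY).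
  - exact: menergy.
  - apply: measurable_funM; first exact: mfg.
    apply: measurable_funM; first exact: mpow.
    apply: mpow; apply: measurable_funD.
      exact: (measurableT_comp (@mnsq _) measurable_snd).
    exact: (measurableT_comp (@mnsq _) measurable_fst).
  - by move=> z; exact: addr_ge0 (EX0 z) (EY0 z).
  - by move=> z; rewrite mulr_ge0// powR_ge0.
  - by move=> z; rewrite mulr_ge0// mulr_ge0// powR_ge0.
  - by rewrite mulr_ge0// powR_ge0.
  - by rewrite mulr_ge0// powR_ge0.
  - move=> [y x]; rewrite /EX /EY /=.
    apply: ler_weighted; first exact: (fgE (y, x)).
    rewrite pmulr_rgt0// g_gt0 => x0.
    have bound2 (a c : R) : 0 <= a -> 0 <= c -> `|a - l * c| <= 2 * (a + c).
      move=> a0 c0; apply: le_trans (ler_normB _ _) _.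
      rewrite normrM !ger0_norm ?(ltW l0)// mulrDr lerD//.
        by rewrite ler_peMl// ler1n.
      by rewrite ler_wpM2r//; lra.
    have := pointwise l (K x y) (nsq x + nsq y)
      (nsq (x - l *: snoc y 0)) (nsq (l *: x - snoc y 0)) l1 l2 (@K_gt0 x y x0)
      (nsq_ge0 _) (nsq_ge0 _).
    have c1 : K x y <= 2 * (nsq x + nsq y) by rewrite -(nsq_snoc0 y) nsqB_le.
    have c2 : nsq (x - l *: snoc y 0) + nsq (l *: x - snoc y 0) =
       2 * l * K x y + (1 - l) ^+ 2 * (nsq x + nsq y) by rewrite nsq_dilD nsq_snoc0.
    have c3 : `|nsq (x - l *: snoc y 0) - l * K x y| <=
        2 * `|1 - l| * (nsq x + nsq y).
      rewrite nsq_dilB1 nsq_snoc0 normrM (mulrC 2) -mulrA ler_wpM2l//.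
      by apply: bound2; exact: nsq_ge0.
    have c4 : `|nsq (l *: x - snoc y 0) - l * K x y| <=
        2 * `|1 - l| * (nsq x + nsq y).
      rewrite nsq_dilB2 nsq_snoc0 normrM (mulrC 2) -mulrA ler_wpM2l// (addrC (nsq x)).
      by apply: bound2; exact: nsq_ge0.
    by move=> /(_ c1 c2 c3 c4).
  - by rewrite IE.
  - exact: WE.
have [A [B [AE BE AB]]] := ge0_integral_sum_real mEX mEY EX0 EY0 XY.
exists A, B; split.
- by rewrite -energy_dilate_u.
- by rewrite -energy_dilate_V.
- by apply: le_trans AB _; rewrite /bnd lerD2l mulrAC.
Qed.

End integral_system.

(** * Dilation balance and the exponent identity *)

Definition last_coord_weight (R : realType) (m : nat) (b : R) (x : 'rV[R]_m.+1) : R :=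
  if 0 < lastc x then lastc x `^ b else 0.

Lemma last_coord_weight_ge0 (R : realType) (m : nat) (b : R) (x : 'rV[R]_m.+1) :
  0 <= last_coord_weight b x.
Proof. by rewrite /last_coord_weight; case: ifP => // _; exact: powR_ge0. Qed.

Lemma last_coord_weight_gt0 (R : realType) (m : nat) (b : R) (x : 'rV[R]_m.+1) :
  (0 < last_coord_weight b x) = (0 < lastc x).
Proof.
by rewrite /last_coord_weight; case: ifP => [|//]; rewrite ?ltxx// => /powR_gt0 ->.
Qed.

Lemma last_coord_weight_scale (R : realType) (m : nat) (b l : R)
    (x : 'rV[R]_m.+1) : 0 < l ->
  last_coord_weight b (l *: x) = l `^ b * last_coord_weight b x.
Proof.
move=> l0; rewrite /last_coord_weight.
have -> : lastc (l *: x) = l * lastc x by rewrite /lastc mxE.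
rewrite pmulr_rgt0//; case: ifPn => [x0|_]; last by rewrite mulr0.
by rewrite powRM// ltW.
Qed.

Lemma measurable_lastc (R : realType) (m : nat) :
  measurable_fun setT (fun x : 'rV[R]_m.+1 => lastc x).
Proof. exact: measurable_coord. Qed.

Lemma measurable_last_coord_weight (R : realType) (m : nat) (b : R) :
  measurable_fun setT (@last_coord_weight R m b).
Proof.
apply: measurable_fun_ifT => //.
  by apply: measurable_fun_ltr => //; exact: measurable_lastc.
exact: (measurableT_comp (measurable_powR b) (@measurable_lastc R m)).
Qed.

(** The lower bounds by concavity and the upper bound by the second difference
    pinch the derivative of the dilated energies at [l = 1]. *)
Lemma dilation_balance (R : realType) (m : nat) (q theta k b : R)
    (u : 'rV[R]_m -> R) (V : 'rV[R]_m.+1 -> R) :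
  (0 < m)%N -> 0 < q -> 0 < theta -> theta != 1 -> 0 < k -> k != 1 ->
  measurable_fun setT u -> measurable_fun setT V ->
  (forall y, 0 < u y) -> (forall x, 0 < V x) ->
  (forall y, (\int[lebesgue_rV R m.+1]_x
     (nsq (x - snoc y 0) `^ q * (last_coord_weight b x * V x `^ (- k)))%:E =
    (u y)%:E)%E) ->
  (forall x, 0 < lastc x -> (\int[lebesgue_rV R m]_y
     (nsq (x - snoc y 0) `^ q * u y `^ (- theta))%:E = (V x)%:E)%E) ->
  2 * q + m%:R / (1 - theta) + (b + m.+1%:R) / (1 - k) = 0.
Proof.
move=> m0 q0 theta0 theta1 k0 k1 mu mV u0 V0 uE VE.
have mpow d (T : measurableType d) (h : T -> R) (s : R) :
    measurable_fun setT h -> measurable_fun setT (fun x => h x `^ s).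
  by move=> mh; exact: (measurableT_comp (measurable_powR s) mh).
have mw := @measurable_last_coord_weight R m b.
pose g x := last_coord_weight b x * V x `^ (- k).
have mg : measurable_fun setT g by apply: measurable_funM => //; exact: mpow.
have g0 x : 0 <= g x by rewrite mulr_ge0 ?last_coord_weight_ge0 ?powR_ge0.
have g_gt0 x : (0 < g x) = (0 < lastc x).
  by rewrite /g pmulr_lgt0 ?powR_gt0// last_coord_weight_gt0.
have [I [C [e [I0 C0 e0 [Iu IV dil]]]]] :=
  dilated_energy_second_difference m0 q0 theta0 mu mg u0 V0 g0 g_gt0 uE VE.
have IuE : (\int[lebesgue_rV R m]_y (1 * u y `^ (1 - theta))%:E = I%:E)%E.
  rewrite -Iu; apply: eq_integral => y _; rewrite mul1r; congr EFin.
  rewrite addrC powRD; last by apply/implyP => _; rewrite gt_eqF.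
  by rewrite powRr1// ltW.
have IVE : (\int[lebesgue_rV R m.+1]_x
    (last_coord_weight b x * V x `^ (1 - k))%:E = I%:E)%E.
  rewrite -IV; apply: eq_integral => x _; congr EFin.
  rewrite /g -mulrA; congr (_ * _).
  rewrite addrC powRD; last by apply/implyP => _; rewrite gt_eqF.
  by rewrite powRr1// ltW.
pose G (l : R) := I * (2 * (l `^ q - 1) - (l `^ (- m%:R) - 1) / (1 - theta) -
  (l `^ (- (b + m.+1%:R)) - 1) / (1 - k)).
have GC l : 2^-1 <= l -> l <= 3 / 2 -> - (C * `|1 - l| `^ (1 + e)) <= G l.
  move=> l1 l2; have l0 : 0 < l by lra.
  have lpow j : l `^ (- j%:R) = l ^- j by rewrite powRN powR_mulrn// ltW.
  have [A [B [AE BE AB]]] := dil l l1 l2.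
  have ml : measurable_fun setT (fun y : 'rV[R]_m => u (l *: y)).
    exact: (measurableT_comp mu (measurable_scale_rV l)).
  have mVl : measurable_fun setT (fun x : 'rV[R]_m.+1 => V (l *: x)).
    exact: (measurableT_comp mV (measurable_scale_rV l)).
  have Al : I * (1 + (l `^ (- m%:R) - 1) / (1 - theta)) <= A.
    apply: (@concave_power_integral_ge _ _ _ (lebesgue_rV R m) (fun=> 1) u
      (fun y => u (l *: y))) => //.
    - under eq_integral do rewrite mul1r.
      rewrite (@ge0_integral_scale_rV _ _ l (fun y => (u y `^ (1 - theta))%:E))//.
      + rewrite lpow EFinM -IuE; congr (_ * _)%E.
        by apply: eq_integral => y _; rewrite mul1r.
      + by apply/measurable_EFinP; exact: mpow.
      + by move=> y; rewrite lee_fin powR_ge0.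
    - by rewrite -AE; apply: eq_integral => y _; rewrite mul1r.
  have Bl : I * (1 + (l `^ (- (b + m.+1%:R)) - 1) / (1 - k)) <= B.
    apply: (@concave_power_integral_ge _ _ _ (lebesgue_rV R m.+1) (last_coord_weight b) V
      (fun x => V (l *: x))) => //.
    - by move=> x; exact: last_coord_weight_ge0.
    - transitivity (\int[lebesgue_rV R m.+1]_x ((l `^ (- b))%:E *
          (last_coord_weight b (l *: x) * V (l *: x) `^ (1 - k))%:E))%E.
        apply: eq_integral => x _; rewrite -EFinM last_coord_weight_scale// !mulrA.
        by rewrite -powRD ?addNr ?powRr0 ?mul1r//; apply/implyP => _; rewrite gt_eqF.
      have mwV : measurable_fun setT (fun x => last_coord_weight b x * V x `^ (1 - k)).
        by apply: measurable_funM => //; exact: mpow.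
      rewrite ge0_integralZl_EFin ?powR_ge0//; last 2 first.
      + by move=> x _; rewrite lee_fin mulr_ge0 ?last_coord_weight_ge0 ?powR_ge0.
      + apply/measurable_EFinP.
        exact: (measurableT_comp mwV (measurable_scale_rV l)).
      rewrite (@ge0_integral_scale_rV _ _ l
        (fun x => (last_coord_weight b x * V x `^ (1 - k))%:E))//; last 2 first.
      + exact/measurable_EFinP.
      + by move=> x; rewrite lee_fin mulr_ge0 ?last_coord_weight_ge0 ?powR_ge0.
      rewrite IVE -!EFinM opprD powRD; last by apply/implyP => _; rewrite gt_eqF.
      by rewrite lpow mulrA.
    - by rewrite -BE; apply: eq_integral => x _; rewrite mulrA.
  have GE : G l = 2 * l `^ q * I - I * (1 + (l `^ (- m%:R) - 1) / (1 - theta)) -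
      I * (1 + (l `^ (- (b + m.+1%:R)) - 1) / (1 - k)) by rewrite /G; ring.
  rewrite GE; clear - Al Bl AB; lra.
have G1 : G 1 = 0 by rewrite /G !powR1; ring.
pose D := I * (2 * q + m%:R / (1 - theta) + (b + m.+1%:R) / (1 - k)).
have dG : is_derive (1 : R) 1 G D.
  have d1 (s : R) : is_derive (1 : R) 1 (fun l : R => l `^ s) s.
    apply: is_derive_eq; first exact: is_derive1_powR.
    by rewrite powR1 mulr1.
  have dp (c s : R) : is_derive (1 : R) 1 (fun l : R => c * (l `^ s - 1)) (c * s).
    have := is_deriveZ c (is_deriveB (d1 s) (is_derive_cst (1 : R) (1 : R) (1 : R))).
    by rewrite subr0.
  have := is_deriveZ I (is_deriveB (is_deriveB (dp 2 q)
    (dp (1 - theta)^-1 (- m%:R))) (dp (1 - k)^-1 (- (b + m.+1%:R)))).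
  rewrite (_ : _ \*: _ = G); last first.
    by apply/funext => l; rewrite /G /=; congr (I * (_ - _ - _)); exact: mulrC.
  move=> h; apply: is_derive_eq h _.
  by rewrite /D /GRing.scale /=; ring.
have := derive_eq0_of_lower_bound C0 e0 dG G1 GC.
by rewrite /D => /eqP; rewrite mulf_eq0 gt_eqF//= => /eqP.
Qed.

Lemma open_halfspace (R : realType) (m : nat) : open (halfspace R m).
Proof.
rewrite (_ : halfspace R m = (fun x : 'rV[R]_m.+1 => lastc x) @^-1` [set t | 0 < t])//.
apply: open_comp; last exact: open_gt.
by move=> x _; exact: coord_continuous.
Qed.

Lemma C1_on_measurable (R : realType) (n : nat) (D : set 'rV[R]_n) (h : 'rV[R]_n -> R) :
  open D -> C1_on D h -> measurable_fun D h.
Proof.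
move=> oD h1; apply: continuous_measurable_rV => // x Dx.
by apply: differentiable_continuous; have [] := h1 x Dx.
Qed.

(* R^n is 'rV[R]_n.-1.+1 and its boundary hyperplane is 'rV[R]_n.-1, with
   y standing for the point snoc y 0 of R^n. *)
Theorem theorem1p5 (R : realType) (n : nat) (alpha beta theta k : R)
  (hn : (2 <= n)%N) (halpha : n%:R < alpha) (hbeta : 0 <= beta)
  (htheta : 0 < theta) (hk : 0 < k) (htheta1 : theta != 1) (hk1 : k != 1)
  (hbk : 0 < beta * (1 - k) + 1)
  (huv : exists (u : 'rV[R]_n.-1 -> R) (v : 'rV[R]_n.-1.+1 -> R),
    [/\ C1_on [set: 'rV[R]_n.-1] u /\ (forall y, 0 < u y),
        C1_on (halfspace R n.-1) v /\ (forall x, halfspace R n.-1 x -> 0 < v x),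
        (forall y : 'rV[R]_n.-1,
          (u y)%:E = (\int[lebesgue_rV R n.-1.+1]_(x in halfspace R n.-1)
            (lastc x `^ (beta * (1 - k)) / enorm (x - snoc y 0) `^ (n%:R - alpha)
               * v x `^ (- k))%:E)%E)
      & (forall x : 'rV[R]_n.-1.+1, halfspace R n.-1 x ->
          (v x)%:E = (\int[lebesgue_rV R n.-1]_(y in [set: 'rV[R]_n.-1])
            (1 / enorm (x - snoc y 0) `^ (n%:R - alpha) * u y `^ (- theta))%:E)%E)]) :
  (n%:R - 1) / (theta - 1) + n%:R / (k - 1) = alpha + beta - n%:R.
Proof.
move: huv => [u [v [[u1 u0] [v1 v0] uE vE]]].
have nE : n = n.-1.+1 by rewrite prednK// ltnW.
have n1 : (0 < n.-1)%N by rewrite -ltnS -nE.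
set m := n.-1 in u v u1 u0 v1 v0 uE vE nE n1 *.
pose q := (alpha - n%:R) / 2.
have q0 : 0 < q by rewrite divr_gt0// subr_gt0.
have kernel (z : 'rV[R]_m.+1) : (enorm z `^ (n%:R - alpha))^-1 = nsq z `^ q.
  by rewrite -powRN opprB enorm_powR.
pose b := beta * (1 - k).
(* [v] is extended by a positive constant, so that its powers are defined and
   measurable everywhere; the weight vanishes there *)
pose V (x : 'rV[R]_m.+1) := if 0 < lastc x then v x else 1.
have mu : measurable_fun setT u by apply: C1_on_measurable => //; exact: openT.
have mV : measurable_fun setT V.
  have mlast : measurable_fun setT (fun x : 'rV[R]_m.+1 => 0 < lastc x).
    by apply: measurable_fun_ltr => //; exact: measurable_lastc.
  apply: measurable_fun_if => //.
  rewrite setTI (_ : _ @^-1` _ = halfspace R m) //.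
  by apply: C1_on_measurable => //; exact: open_halfspace.
have V0 x : 0 < V x by rewrite /V; case: ifP => // /v0.
have uE' y : (\int[lebesgue_rV R m.+1]_x
    (nsq (x - snoc y 0) `^ q * (last_coord_weight b x * V x `^ (- k)))%:E = (u y)%:E)%E.
  rewrite uE [RHS]integral_mkcond; apply: eq_integral => x _.
  rewrite patchE /V /last_coord_weight kernel; case: ifPn => x0.
    by rewrite mem_set//; congr EFin; rewrite mulrA (mulrC (nsq _ `^ q)).
  by rewrite memNset ?mul0r ?mulr0//; exact/negP.
have VE x : 0 < lastc x -> (\int[lebesgue_rV R m]_y
    (nsq (x - snoc y 0) `^ q * u y `^ (- theta))%:E = (V x)%:E)%E.
  move=> x0; rewrite /V x0 vE//; apply: eq_integral => y _.
  by rewrite div1r kernel.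
have := dilation_balance n1 q0 htheta htheta1 hk hk1 mu mV u0 V0 uE' VE.
rewrite -nE (_ : m%:R = n%:R - 1 :> R); last by rewrite [in RHS]nE -natr1 addrK.
have -> : 2 * q = alpha - n%:R by rewrite /q mulrC divfK.
have t1 : 1 - theta != 0 by rewrite subr_eq0 eq_sym.
have k1 : 1 - k != 0 by rewrite subr_eq0 eq_sym.
have -> : (b + n%:R) / (1 - k) = beta + n%:R / (1 - k).
  by rewrite mulrDl /b mulfK.
rewrite -(opprB 1 theta) -(opprB 1 k) !invrN !mulrN.
move=> H; apply/eqP; rewrite -subr_eq0; apply/eqP.
by rewrite -[RHS]oppr0 -H; ring.
Qed.
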